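(* Let $X$ be a simplicial tree or a uniformly locally finite hyperbolic graph, and let $G$ be any finitely generated group acting on $X$ acylindrically. Then any loxodromic element of $G$ is Morse in $G$.
   Context: Graphs are metric graphs with edges of length 1, groups act by graph isometries, ''hyperbolic'' means Gromov hyperbolic, and ''uniformly locally finite'' means that the vertex degrees are uniformly bounded. An action of $G$ on $X$ is acylindrical if for some $l>0$ the stabilizers in $G$ of pairs of points of $X$ at distance $\ge l$ are finite of uniformly bounded sizes. An isometry $\alpha$ of $X$ is loxodromic if some power $\alpha^k$, $k\geq 1$, stabilizes a bi-infinite geodesic $\mathfrak p$ and $\langle\alpha^k\rangle$ acts on $\mathfrak p$ co-compactly (equivalently here, no power of $\alpha$ fixes a point of $X$). A bi-infinite quasi-geodesic $\mathfrak q$ in a metric space is Morse if for every $L\ge 1$, $C\ge 0$ there is $M=M(L,C)$ such that every $(L,C)$-quasi-geodesic with endpoints on the image of $\mathfrak q$ is contained in the $M$-neighborhood of $\mathfrak q$. An element $g$ of a finitely generated group $G$ is Morse in $G$ if $(g^n)_{n\in\mathbb Z}$ is a Morse quasi-geodesic in a Cayley graph of $G$ with respect to a finite generating set. *)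

(* Defs.v *)
From HB Require Import structures.
From mathcomp Require Import all_boot all_order all_algebra.
From mathcomp Require Import all_classical all_reals all_analysis.
From mathcomp Require Import lra.

Set Implicit Arguments.
Unset Strict Implicit.
Unset Printing Implicit Defensive.

Import Order.TTheory GRing.Theory Num.Theory.

Local Open Scope classical_set_scope.
Local Open Scope card_scope.
Local Open Scope ring_scope.

(* Loops and multiple edges are allowed. The orientation of an edge is an
   arbitrary choice, used only to parametrize it by the unit interval; a dart
   [(e, b)] is the edge [e] traversed from [src e] to [tgt e] when [b = false],
   and from [tgt e] to [src e] when [b = true]. *)
Record multigraph := Multigraph {
  vert : eqType;
  edge : eqType;
  src : edge -> vert;
  tgt : edge -> vert }.

Section Walks.
Variable X : multigraph.

Definition dart : Type := (edge X * bool)%type.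
Definition dsrc (d : dart) : vert X := if d.2 then tgt d.1 else src d.1.
Definition dtgt (d : dart) : vert X := if d.2 then src d.1 else tgt d.1.

Fixpoint walk (v : vert X) (p : seq dart) (w : vert X) : Prop :=
  if p is d :: p' then dsrc d = v /\ walk (dtgt d) p' w else v = w.

(* Distinct edges matter for length 2: going back and forth along one edge is
   not a circuit, whereas two parallel edges form one. *)
Definition circuit (v : vert X) (p : seq dart) : Prop :=
  [/\ p != [::], walk v p v, uniq (map dsrc p) & uniq [seq d.1 | d <- p]].

End Walks.

Record graph := Graph {
  graph_base :> multigraph;
  graph_connected : forall v w : vert graph_base, exists p, walk v p w }.

Definition simplicial_tree (X : graph) : Prop :=
  ~ exists (v : vert X) (p : seq (dart X)), circuit v p.

(* Degrees are counted in darts, so a loop contributes 2. *)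
Definition uniformly_locally_finite (X : graph) : Prop :=
  exists N : nat, forall v : vert X, [set d : dart X | dsrc d = v] #<= `I_N.

Section VertexDistance.
Variable X : graph.

Lemma exists_walk_size (v w : vert X) :
  exists n : nat, `[< exists2 p, walk v p w & size p = n >].
Proof.
by have [p vpw] := graph_connected v w; exists (size p); apply/asboolP; exists p.
Qed.

Definition vdist (v w : vert X) : nat := ex_minn (exists_walk_size v w).

Lemma vdist_le v w p : walk v p w -> (vdist v w <= size p)%N.
Proof.
move=> vpw; rewrite /vdist; case: ex_minnP => n _; apply.
by apply/asboolP; exists p.
Qed.

Lemma vdist_walk v w : exists2 p, walk v p w & size p = vdist v w.
Proof. by rewrite /vdist; case: ex_minnP => n /asboolP. Qed.

Lemma walk_cat u v w p q : @walk X u p v -> walk v q w -> walk u (p ++ q) w.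
Proof. by elim: p u => [u ->//|d p IH u /= [-> /IH h] /h]. Qed.

Lemma walk_rev v w p : @walk X v p w ->
  exists2 q, walk w q v & size q = size p.
Proof.
elim: p v => [v ->|d p IH v /= [<- /IH[q wq sq]]]; first by exists [::].
exists (q ++ [:: (d.1, ~~ d.2)]); last by rewrite size_cat sq addn1.
by apply: walk_cat wq _; case: d => e [].
Qed.

Lemma vdist_sym v w : vdist v w = vdist w v.
Proof.
suff le a b : (vdist a b <= vdist b a)%N by apply/eqP; rewrite eqn_leq !le.
have [p bpa <-] := vdist_walk b a.
by have [q aqb <-] := walk_rev bpa; exact: vdist_le.
Qed.

Lemma vdist_triangle u v w : (vdist u w <= vdist u v + vdist v w)%N.
Proof.
have [p upv <-] := vdist_walk u v; have [q vqw <-] := vdist_walk v w.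
by rewrite -size_cat; apply/vdist_le/(walk_cat upv).
Qed.

Lemma vdistxx v : vdist v v = 0%N.
Proof. by apply/eqP; rewrite -leqn0 (@vdist_le v v [::]). Qed.

Lemma vdist_eq0 v w : vdist v w = 0%N -> v = w.
Proof.
by have [p vpw <-] := vdist_walk v w => /size0nil p0; move: vpw; rewrite p0.
Qed.

Lemma vdist_edge (e : edge X) : (vdist (src e) (tgt e) <= 1)%N.
Proof. exact: (@vdist_le _ _ [:: (e, false)]). Qed.

End VertexDistance.

(* [Interior e s] is the point of the open edge [e] at distance [s] from
   [src e] along [e]. *)
Variant metric_graph (R : realType) (X : graph) : Type :=
  | Vertex of vert X
  | Interior of edge X & {s : R | 0 < s < 1}.

Arguments Vertex {R X} v.
Arguments Interior {R X} e s.

HB.instance Definition _ R X := gen_eqMixin (metric_graph R X).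
HB.instance Definition _ R X := gen_choiceMixin (metric_graph R X).

Section PathMetric.
Variables (R : realType) (X : graph).
Implicit Types x y z : metric_graph R X.

(* The two ways of leaving the open edge containing [x]: the vertex which is
   reached, and the distance to it along the edge. *)
Definition foot x (b : bool) : vert X :=
  match x with
  | Vertex v => v
  | Interior e _ => if b then tgt e else src e
  end.

Definition leg x (b : bool) : R :=
  match x with
  | Vertex _ => 0
  | Interior _ s => if b then 1 - val s else val s
  end.

Definition via x y (b c : bool) : R :=
  leg x b + (vdist (foot x b) (foot y c))%:R + leg y c.

Definition dist_via x y : R :=
  Num.min (Num.min (via x y false false) (via x y false true))
          (Num.min (via x y true false) (via x y true true)).

(* The path metric with edges of length 1: a shortest path from [x] to [y]
   either stays inside a common open edge, or passes through an end of the
   edge of [x] and an end of the edge of [y]. *)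
Definition path_dist x y : R :=
  match x, y with
  | Interior e s, Interior f t =>
      if e == f then Num.min `|val s - val t| (dist_via x y) else dist_via x y
  | _, _ => dist_via x y
  end.

Definition same_edge_dist x y (r : R) : Prop :=
  exists e s t, [/\ x = Interior e s, y = Interior e t & r = `|val s - val t|].

Lemma leg_ge0 x b : 0 <= leg x b.
Proof.
by case: x => //= e [s /= /andP[s0 s1]]; case: b => /=; rewrite ?subr_ge0 ltW.
Qed.

Lemma dist_via_le x y b c : dist_via x y <= via x y b c.
Proof. by rewrite /dist_via !ge_min; case: b; case: c; rewrite lexx ?orbT. Qed.

Lemma dist_viaP x y : exists b c, dist_via x y = via x y b c.
Proof.
rewrite /dist_via /Num.min.
by repeat case: ifP => _; first [by exists false, false | by exists false, true
  | by exists true, false | by exists true, true].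
Qed.

Lemma path_distP x y :
  (exists b c, path_dist x y = via x y b c) \/ same_edge_dist x y (path_dist x y).
Proof.
case: x y => [v|e s] [w|f t] /=; try by left; exact: dist_viaP.
case: eqP => [<-|_]; last by left; exact: dist_viaP.
rewrite {1 2}/Num.min; case: ifP => _; first by right; exists e, s, t.
by left; exact: dist_viaP.
Qed.

Lemma path_dist_via x y b c : path_dist x y <= via x y b c.
Proof.
suff h : path_dist x y <= dist_via x y by exact: le_trans h (dist_via_le _ _ _ _).
by case: x y => [v|e s] [w|f t] //=; case: ifP => // _; rewrite ge_min lexx orbT.
Qed.

Lemma path_dist_same x y r : same_edge_dist x y r -> path_dist x y <= r.
Proof. by move=> [e [s [t [-> -> ->]]]] /=; rewrite eqxx ge_min lexx. Qed.

Lemma via_sym x y b c : via x y b c = via y x c b.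
Proof. by rewrite /via vdist_sym addrC addrA addrAC -!addrA [X in _ + X]addrC. Qed.

Lemma same_edge_sym x y r : same_edge_dist x y r -> same_edge_dist y x r.
Proof. by move=> [e [s [t [-> -> ->]]]]; exists e, t, s; rewrite distrC. Qed.

Lemma path_dist_sym x y : path_dist x y = path_dist y x.
Proof.
suff le a b : path_dist a b <= path_dist b a by apply/eqP; rewrite eq_le !le.
case: (path_distP b a) => [[i [j ->]]|/same_edge_sym]; last exact: path_dist_same.
by rewrite via_sym path_dist_via.
Qed.

Lemma foot_diam x b c : (vdist (foot x b) (foot x c))%:R <= leg x b + leg x c
  \/ b = c.
Proof.
case: x => [v|e s] /=; first by left; rewrite vdistxx addr0.
have h : (vdist (src e) (tgt e))%:R <= 1 :> R by rewrite lern1 vdist_edge.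
case: b c => -[]; [by right|left|left|by right].
  by rewrite vdist_sym subrK.
by rewrite addrC subrK.
Qed.

Lemma via_triangle x y z b c c' d :
  path_dist x z <= via x y b c + via y z c' d.
Proof.
apply: le_trans (path_dist_via _ _ b d) _; rewrite /via.
have h1 : (vdist (foot x b) (foot z d))%:R <=
   (vdist (foot x b) (foot y c))%:R + (vdist (foot y c) (foot z d))%:R :> R.
  by rewrite -natrD ler_nat vdist_triangle.
have h2 : (vdist (foot y c) (foot z d))%:R <=
   (vdist (foot y c) (foot y c'))%:R + (vdist (foot y c') (foot z d))%:R :> R.
  by rewrite -natrD ler_nat vdist_triangle.
have := leg_ge0 y c; have := leg_ge0 y c'.
case: (foot_diam y c c') => [h3|cc']; first lra.
by move: h1 h2; rewrite -cc' vdistxx; lra.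
Qed.

Lemma via_same_triangle x y z r c d :
  same_edge_dist x y r -> path_dist x z <= r + via y z c d.
Proof.
move=> [e [s [t [-> -> ->]]]]; apply: le_trans (path_dist_via _ _ c d) _.
rewrite /via /=; have := ler_norm (val s - val t).
have := ler_norm (val t - val s); rewrite (distrC (val t)); case: c => /=; lra.
Qed.

Lemma path_dist_triangle y x z : path_dist x z <= path_dist x y + path_dist y z.
Proof.
case: (path_distP x y) => [[b [c ->]]|xy]; case: (path_distP y z) => [[c' [d ->]]|yz].
- exact: via_triangle.
- rewrite path_dist_sym (via_sym x) addrC.
  exact/via_same_triangle/same_edge_sym.
- exact: via_same_triangle.
- case: xy yz => [e [s [t [xe ye ->]]]] [f [t' [u [yf zf ->]]]].
  move: yf; rewrite ye => -[ef tt']; rewrite -{}ef -{}tt' in zf *.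
  rewrite xe zf; apply: (@le_trans _ _ `|val s - val u|).
    by apply: path_dist_same; exists e, s, u.
  by rewrite (le_trans _ (ler_normD _ _)) // addrA subrK.
Qed.

Lemma path_distxx x : path_dist x x = 0.
Proof.
have ge0 : 0 <= path_dist x x.
  case: (path_distP x x) => [[b [c ->]]|[e [s [t [_ _ ->]]]]] //.
  by rewrite /via !addr_ge0 ?leg_ge0.
apply/eqP; rewrite eq_le ge0 andbT; case: x {ge0} => [v|e s].
  by rewrite (le_trans (path_dist_via _ _ true true))// /via /= vdistxx !addr0.
by apply: path_dist_same; exists e, s, s; rewrite subrr normr0.
Qed.

Lemma path_dist_eq0 x y : path_dist x y = 0 -> x = y.
Proof.
case: (path_distP x y) => [[b [c ->]]|[e [s [t [-> -> ->]]]]]; last first.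
  by move/normr0_eq0/eqP; rewrite subr_eq0 => /eqP/val_inj ->.
have pos e s b' : 0 < leg (Interior e s : metric_graph R X) b'.
  by case: s b' => s /= /andP[s0 s1] []; rewrite ?subr_gt0.
rewrite /via => h; have := leg_ge0 x b; have := leg_ge0 y c.
have d0 : 0 <= (vdist (foot x b) (foot y c))%:R :> R by [].
case: x y h d0 => [v|e s] [w|f t].
- move=> /= h _ _ _; congr Vertex; apply: vdist_eq0.
  by move/eqP: h; rewrite add0r addr0 pnatr_eq0 => /eqP.
- by move=> h d0 lx ly; exfalso; have := pos f t c; lra.
- by move=> h d0 lx ly; exfalso; have := pos e s b; lra.
- by move=> h d0 lx ly; exfalso; have := pos e s b; lra.
Qed.

HB.instance Definition _ := isMetric.Build R (metric_graph R X)
  path_distxx path_dist_eq0 path_dist_sym path_dist_triangle.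

End PathMetric.

Section Coarse.
Variables (R : realType) (T : metricType R).
Implicit Types (L C : R) (I : set R) (q : R -> T).

Definition gromov_product (w x y : T) : R :=
  (mdist x w + mdist y w - mdist x y) / 2.

Definition gromov_hyperbolic : Prop :=
  exists2 delta : R, 0 <= delta & forall w x y z : T,
    Num.min (gromov_product w x y) (gromov_product w y z) - delta
      <= gromov_product w x z.

Definition bi_infinite_geodesic q : Prop :=
  forall s t, mdist (q s) (q t) = `|s - t|.

Definition quasi_geodesic L C I q : Prop :=
  forall s t, I s -> I t ->
    L^-1 * `|s - t| - C <= mdist (q s) (q t) <= L * `|s - t| + C.

Definition bi_infinite_quasi_geodesic q : Prop :=
  exists L C, [/\ 1 <= L, 0 <= C & quasi_geodesic L C setT q].

Definition morse_quasi_geodesic q : Prop :=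
  bi_infinite_quasi_geodesic q /\
  forall L C, 1 <= L -> 0 <= C -> exists M : R,
    forall (a b : R) (r : R -> T), a <= b ->
      quasi_geodesic L C `[a, b] r -> range q (r a) -> range q (r b) ->
      forall t, t \in `[a, b] -> exists s, mdist (r t) (q s) <= M.

End Coarse.

Arguments gromov_hyperbolic {R} T.

Definition gpow (G : groupType) (g : G) (n : int) : G :=
  match n with Posz k => (g ^+ k)%g | Negz k => (g ^- k.+1)%g end.

Section Actions.
Variables (R : realType) (X : graph) (G : groupType).
Variable act : G -> metric_graph R X -> metric_graph R X.

(* Edges may be inverted. *)
Definition graph_isometry (f : metric_graph R X -> metric_graph R X) : Prop :=
  [/\ forall x y, mdist (f x) (f y) = mdist x y,
      forall v, exists w, f (Vertex v) = Vertex w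
    & forall e, exists e', forall s, exists t, f (Interior e s) = Interior e' t].

Definition acts_by_graph_isometries : Prop :=
  [/\ forall x, act 1%g x = x,
      forall g h x, act (g * h)%g x = act g (act h x)
    & forall g, graph_isometry (act g)].

Definition acylindrical : Prop :=
  exists2 l : R, 0 < l & exists N : nat, forall x y, l <= mdist x y ->
    [set g | act g x = x /\ act g y = y] #<= `I_N.

Definition acts_cocompactly_on (h : G) (A : set (metric_graph R X)) : Prop :=
  exists K : set (metric_graph R X),
    [/\ compact K, K `<=` A & A `<=` \bigcup_n (act (gpow h n) @` K)].

Definition loxodromic (g : G) : Prop :=
  exists (k : nat) (p : R -> metric_graph R X),
    [/\ (1 <= k)%N, bi_infinite_geodesic p,
        act (g ^+ k)%g @` range p = range p
      & acts_cocompactly_on (g ^+ k)%g (range p)].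

End Actions.

Section Cayley.
Variables (G : groupType) (S : seq G).

Definition generates : Prop :=
  forall g : G, exists2 w : seq G,
    all (fun x => (x \in S) || (x^-1%g \in S)) w & g = (\prod_(x <- w) x)%g.

Definition cayley_multigraph : multigraph :=
  @Multigraph G (G * {s : G | s \in S})%type
    (fun e => e.1) (fun e => (e.1 * val e.2)%g).

Hypothesis genS : generates.

Lemma cayley_connected (v w : vert cayley_multigraph) : exists p, walk v p w.
Proof.
have [u uS wE] := genS (v^-1 * w)%g.
have {wE} -> : w = (v * \prod_(x <- u) x)%g by rewrite -wE mulVKg.
elim: u v uS => [v _|x u IH v /= /andP[xS /IH{}IH]].
  by exists [::]; rewrite big_nil mulg1.
have [p hp] := IH (v * x)%g.
rewrite big_cons mulgA; case/orP: xS => xS.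
  by exists ((v, exist _ x xS, false) :: p).
exists (((v * x)%g, exist _ x^-1%g xS, true) :: p); split=> //=.
by rewrite /dsrc /= mulgK.
Qed.

Definition cayley_graph : graph := Graph cayley_connected.

End Cayley.

Definition finitely_generated (G : groupType) : Prop :=
  exists S : seq G, generates S.

(* The bi-infinite sequence of powers of [g], as a map on the real line. *)
Definition power_path (R : realType) (G : groupType) (S : seq G)
    (genS : generates S) (g : G) (t : R) : metric_graph R (cayley_graph genS) :=
  Vertex (gpow g (Num.floor t) : vert (cayley_graph genS)).

(* The property does not depend on the finite generating set; it is required
   for all of them. *)
Definition morse_element (R : realType) (G : groupType) (g : G) : Prop :=
  finitely_generated G /\
  forall (S : seq G) (genS : generates S),
    morse_quasi_geodesic (power_path genS g : R -> _).

(* Main.v *)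
(** An acylindrical action satisfies the following weak proper discontinuity:
    only finitely many group elements move the two ends of a long segment of [X]
    close to given points (count translates of the ends if [X] is locally
    finite, and of two vertices inside the segment if [X] is a tree). The
    coordinate along the axis of [g] of a point of [X] at distance [r] from the
    axis is unchanged, up to a constant, by moves of size about [2 r]. Hence, at
    a definite speed along the axis, a path in [G] must have, within bounded
    time, two points [u], [u'] near the axis and far apart. Modulo powers of
    [g], discontinuity leaves finitely many choices for [u], so [u] is at
    bounded distance from the powers of [g] in [G]. Thus paths avoiding a
    neighborhood of the powers of [g] progress along the axis more slowly than
    any given rate, and a quasi-geodesic of [G] with ends on the powers of [g]
    can only leave this neighborhood for a bounded time. *)

Require Import Defs.
From mathcomp Require Import all_boot all_order all_algebra.
From mathcomp Require Import all_classical all_reals all_analysis.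
From mathcomp Require Import ring lra zify.

Set Implicit Arguments.
Unset Strict Implicit.
Unset Printing Implicit Defensive.

Import Order.TTheory GRing.Theory Num.Theory.

Local Open Scope classical_set_scope.
Local Open Scope ring_scope.

(** * Coordinates along an axis in a hyperbolic space *)

Section FourPoint.
Variables (R : realType) (T : metricType R).
Implicit Types (delta r : R) (a b x y z w : T).

(** A basepoint-free form of Gromov hyperbolicity: of the three sums of distances over opposite
    pairs, the two largest differ by at most [2 * delta]. *)
Definition four_point delta : Prop := forall x y z w : T,
  mdist x y + mdist z w <=
    Num.max (mdist x z + mdist y w) (mdist x w + mdist y z) + 2 * delta.

Lemma gromov_hyperbolic_four_point :
  gromov_hyperbolic T -> exists2 delta, 0 <= delta & four_point delta.
Proof.
move=> [delta d0 hyp]; exists delta => // x y z w.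
have := hyp w x z y; rewrite /gromov_product /Num.min /Num.max (metric_sym z y).
by case: ifP => c1; case: ifP => c2; move: c1 c2; rewrite ?ltNge; lra.
Qed.

(** In a tree this is the signed position, measured from the midpoint of the segment from [a] to
    [b], of the projection of [x]. *)
Definition axis_coord a b x : R := (mdist x a - mdist x b) / 2.

(** The Gromov product of [a] and [b] based at [x]; in a tree, the distance from [x] to the
    segment. *)
Definition axis_height a b x : R := (mdist x a + mdist x b - mdist a b) / 2.

Lemma axis_coord_lip a b x y :
  `|axis_coord a b x - axis_coord a b y| <= mdist x y.
Proof.
have := metric_triangle x y a; have := metric_triangle y x a.
have := metric_triangle x y b; have := metric_triangle y x b.
by rewrite /axis_coord (metric_sym y x) ler_norml => *; lra.
Qed.

(** By hypothesis [mdist x y + mdist a b + 2 * delta] is below the average of the other two sums of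
    the four-point condition. The condition then makes these the two largest sums, and the
    coordinates differ by half of their difference. *)
Lemma axis_coord_contract delta a b x y : 0 <= delta -> four_point delta ->
  mdist x y + 2 * delta < axis_height a b x + axis_height a b y ->
  `|axis_coord a b x - axis_coord a b y| <= delta.
Proof.
move=> d0 fp; have := fp x a y b; have := fp x b y a.
rewrite /axis_height /axis_coord /Num.max (metric_sym b a) (metric_sym b y).
rewrite (metric_sym a y) ler_norml.
by case: ifP => _; case: ifP => _; lra.
Qed.

(** The path is cut into blocks of [J] steps. The ends of a block are at most [J%:R * lam] apart but
    have height at least [r], so each block moves the coordinate by at most [delta]. *)
Lemma axis_coord_far_progress delta lam r a b (J : nat) (w : nat -> T) n :
  0 <= delta -> four_point delta -> 0 <= lam -> (0 < J)%N ->
  J%:R * lam + 2 * delta < 2 * r ->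
  (forall i, (i < n)%N -> mdist (w i) (w i.+1) <= lam) ->
  (forall i, (i <= n)%N -> r <= axis_height a b (w i)) ->
  `|axis_coord a b (w 0%N) - axis_coord a b (w n)| <= delta * (n%:R / J%:R + 1).
Proof.
move=> d0 fp lam0 J0 rJ.
elim/ltn_ind: n w => n IH w step far.
have JR : 0 < J%:R :> R by rewrite ltr0n.
have near m : (m <= n)%N -> (m <= J)%N ->
    `|axis_coord a b (w 0%N) - axis_coord a b (w m)| <= delta.
  move=> mn mJ; apply: axis_coord_contract => //.
  have dm : mdist (w 0%N) (w m) <= m%:R * lam.
    elim: m mn {mJ} => [|m IHm] mn; first by rewrite mdistxx mul0r.
    rewrite (le_trans (metric_triangle _ (w m) _))// -natr1 mulrDl mul1r.
    by rewrite lerD ?step// IHm// ltnW.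
  have := far _ (leq0n n); have := far _ mn.
  have : m%:R * lam <= J%:R * lam by rewrite ler_wpM2r// ler_nat.
  lra.
have [nJ|Jn] := leqP n J.
  apply: le_trans (near _ (leqnn n) nJ) _.
  by rewrite ler_peMr// lerDr divr_ge0.
have : `|axis_coord a b (w J) - axis_coord a b (w n)|
    <= delta * ((n - J)%:R / J%:R + 1).
  have := IH (n - J)%N _ (fun i => w (J + i)%N).
  rewrite addn0 subnKC; last exact: ltnW.
  apply; first by lia.
    by move=> i iJ; rewrite addnS; apply: step; lia.
  by move=> i iJ; apply: far; lia.
have := near J (ltnW Jn) (leqnn J).
rewrite natrB 1?ltnW// mulrBl divff ?gt_eqF// subrK mulrDr mulr1.
set u := axis_coord _ _ _; set v := axis_coord _ _ _; set t := axis_coord _ _ _.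
move=> uv vt; rewrite -(subrKA v) addrC (le_trans (ler_normD _ _))//; lra.
Qed.

Variable p : R -> T.
Hypothesis geo : bi_infinite_geodesic p.

(** The points [p (- t0)] and [p t0] stand for the two ends of the axis. The estimates on paths are
    uniform in [t0], which can therefore be chosen last. *)
Lemma axis_coord_geodesic t0 t : `|t| <= t0 ->
  axis_coord (p (- t0)) (p t0) (p t) = t.
Proof.
rewrite ler_norml => /andP[h1 h2]; rewrite /axis_coord !geo opprK.
by rewrite ger0_norm 1?ler0_norm; lra.
Qed.

(** Taking the point of the axis with the same coordinate as [x] makes both sums on the right of the
    four-point inequality equal to the height plus the length of the segment. *)
Lemma axis_height_dist delta t0 x : 0 <= t0 -> four_point delta ->
  mdist x (p (axis_coord (p (- t0)) (p t0) x))
    <= axis_height (p (- t0)) (p t0) x + 2 * delta.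
Proof.
move=> t00 fp; set t := axis_coord _ _ _.
have ab : mdist (p (- t0)) (p t0) = 2 * t0.
  by rewrite geo ler0_norm; lra.
have tt0 : `|t| <= t0.
  have := metric_triangle x (p t0) (p (- t0)).
  have := metric_triangle x (p (- t0)) (p t0).
  by rewrite /t /axis_coord (metric_sym (p t0)) ab ler_norml; lra.
have := axis_coord_geodesic tt0; rewrite {1}/axis_coord.
have := fp x (p t) (p (- t0)) (p t0).
have : mdist (p t) (p (- t0)) + mdist (p t) (p t0) = 2 * t0.
  move: tt0; rewrite ler_norml => /andP[? ?].
  by rewrite !geo ger0_norm 1?ler0_norm; lra.
rewrite /axis_height /t /axis_coord /Num.max ab.
by case: ifP => _; lra.
Qed.

End FourPoint.

(** * Walks and trees *)


Section WalkVertices.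
Variable X : graph.
Implicit Types (u v w a b x : vert X) (p q : seq (dart X)) (d : dart X).

Definition walk_verts p w : seq (vert X) := rcons (map (@dsrc X) p) w.

Definition dart_rev d : dart X := (d.1, ~~ d.2).

Lemma dsrc_rev d : dsrc (dart_rev d) = dtgt d.
Proof. by case: d => e []. Qed.

Lemma dtgt_rev d : dtgt (dart_rev d) = dsrc d.
Proof. by case: d => e []. Qed.

Lemma walk_verts_cons d p w :
  walk_verts (d :: p) w = dsrc d :: walk_verts p w.
Proof. by []. Qed.

Lemma walk_verts_cat p q w :
  walk_verts (p ++ q) w = map (@dsrc X) p ++ walk_verts q w.
Proof. by rewrite /walk_verts map_cat rcons_cat. Qed.

Lemma walk_verts_head u p w : walk u p w -> u \in walk_verts p w.
Proof.
by case: p => [->|d p /= [<- _]]; rewrite /walk_verts ?mem_head//= inE eqxx.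
Qed.

Lemma walk_verts_last p w : w \in walk_verts p w.
Proof. by rewrite /walk_verts mem_rcons mem_head. Qed.

Lemma walk_split u p w x : walk u p w -> x \in walk_verts p w ->
  exists p1 p2, [/\ p = p1 ++ p2, walk u p1 x & walk x p2 w].
Proof.
elim: p u => [|d p IH] u /=.
  by move=> <-; rewrite /walk_verts inE => /eqP ->; exists [::], [::].
case=> du wp; rewrite /walk_verts /= inE => /orP[/eqP ->|xp].
  by exists [::], (d :: p).
by have [p1 [p2 [-> h1 h2]]] := IH _ wp xp; exists (d :: p1), p2.
Qed.

Lemma walk_reverse u p w : walk u p w ->
  exists2 q, walk w q u & walk_verts q u =i walk_verts p w.
Proof.
elim: p u => [u ->|d p IH u /= [<- /IH[q wq eq_qp]]]; first by exists [::].
exists (q ++ [:: dart_rev d]).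
  by apply: walk_cat wq _; rewrite /= dsrc_rev dtgt_rev.
move=> x; rewrite walk_verts_cat /walk_verts /= !inE -eq_qp dsrc_rev.
by rewrite !(mem_cat, mem_rcons, inE); do !case: (_ == _) => //=; case: (_ \in _).
Qed.

Lemma simple_walk u p w : walk u p w ->
  exists q, [/\ walk u q w, uniq (walk_verts q w)
    & {subset walk_verts q w <= walk_verts p w}].
Proof.
elim: p u => [u ->|d p IH u /= [<- /IH[q [wq uq sub]]]]; first by exists [::]; split.
have [dq|dq] := boolP (dsrc d \in walk_verts q w); last first.
  exists (d :: q); split => //; first by rewrite /walk_verts /= dq.
  by move=> x; rewrite /walk_verts /= !inE => /orP[->//|/sub ->]; rewrite orbT.
have [q1 [q2 [eq_q _ wq2]]] := walk_split wq dq.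
exists q2; split => //; move: uq sub; rewrite eq_q walk_verts_cat.
  by rewrite cat_uniq => /and3P[].
by move=> _ sub x xq; rewrite /walk_verts /= inE sub ?orbT// mem_cat xq orbT.
Qed.

Lemma walk_dart_verts u p w d : walk u p w -> d \in p ->
  dsrc d \in walk_verts p w /\ dtgt d \in walk_verts p w.
Proof.
elim: p u => [//|d' p IH] u [_ wp]; rewrite in_cons => /orP[/eqP ->|/(IH _ wp)[]].
  by rewrite !walk_verts_cons !inE eqxx (walk_verts_head wp) orbT.
by rewrite walk_verts_cons !inE => -> ->; rewrite !orbT.
Qed.

Lemma walk_edge_verts u p w d : walk u p w -> d.1 \in map fst p ->
  dsrc d \in walk_verts p w /\ dtgt d \in walk_verts p w.
Proof.
move=> wp /mapP[d' d'p eqd]; have [] := walk_dart_verts wp d'p.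
by case: d d' eqd {d'p} => e b [e' b'] /= <-; case: b; case: b'.
Qed.

(** If the edge of a dart is used again later, in either direction, the source of the dart is
    visited again. *)
Lemma simple_walk_edges u p w :
  walk u p w -> uniq (walk_verts p w) -> uniq (map fst p).
Proof.
elim: p u => [//|d p IH] u /= [_ wp] /andP[dp up]; rewrite (IH _ wp up) andbT.
by apply: contra dp => /(walk_edge_verts wp)[].
Qed.

End WalkVertices.

Section Between.
Variable X : graph.
Implicit Types (x y z a b m : vert X).

Definition between m a b : Prop := (vdist a m + vdist m b)%N = vdist a b.

Lemma geodesic_between a p b m : walk a p b -> size p = vdist a b ->
  m \in walk_verts p b -> between m a b.
Proof.
move=> wp sp /(walk_split wp)[p1 [p2 [pE /vdist_le h1 /vdist_le h2]]].
apply/eqP; rewrite eqn_leq vdist_triangle andbT -sp pE size_cat.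
exact: leq_add.
Qed.

Lemma first_step m a : m <> a -> exists d p, [/\ dsrc d = m,
  walk (dtgt d) p a, (size p).+1 = vdist m a & m \notin walk_verts p a].
Proof.
move=> ma; have [[|d p] /=] := vdist_walk m a; first by move/ma.
move=> [dm wp] sp; exists d, p; split => //; apply/negP => /(walk_split wp).
move=> [p1 [p2 [pE _ /vdist_le]]].
by move: sp; rewrite pE size_cat => <-; rewrite ltnNge leq_addl.
Qed.

Lemma between_point a b n : (n <= vdist a b)%N ->
  exists2 m, between m a b & vdist a m = n.
Proof.
elim: n => [|n IH] nab.
  by exists a; rewrite /between vdistxx.
have [m mab am] := IH (ltnW nab).
have mb : m <> b by move=> mb; move: nab; rewrite -am mb ltnn.
have [d [p [dm /vdist_le wp sp _]]] := first_step mb.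
have dd : (vdist m (dtgt d) <= 1)%N by apply: (@vdist_le _ _ _ [:: d]).
move: mab; rewrite /between => mab.
have := vdist_triangle a m (dtgt d); have := vdist_triangle a (dtgt d) b.
by exists (dtgt d); rewrite /between; lia.
Qed.

End Between.

Section Trees.
Variable X : graph.
Hypothesis treeX : simplicial_tree X.
Implicit Types (x y z a b m : vert X).

(* Otherwise the two edges at [m] on a geodesic from [a] to [b], together with
   a simple walk avoiding [m] between their other ends, would form a circuit. *)
Lemma tree_between_cut m a b p :
  between m a b -> walk a p b -> m \in walk_verts p b.
Proof.
move=> mab wp; apply: contraT => mp; exfalso.
have ma : m <> a by move=> ma; move: mp; rewrite ma (walk_verts_head wp).
have mb : m <> b by move=> mb; move: mp; rewrite mb walk_verts_last.
have [d1 [p1 [d1m wp1 sp1 mp1]]] := first_step ma.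
have [d2 [p2 [d2m wp2 sp2 mp2]]] := first_step mb.
have [rp wrp rpE] := walk_reverse wp.
have [rp1 wrp1 rp1E] := walk_reverse wp1.
(* A common first step would bring [m] closer to both [a] and [b], against betweenness. *)
have neq : dtgt d1 <> dtgt d2.
  move=> e; move: (vdist_le wp1) (vdist_le wp2); rewrite -e.
  have := vdist_triangle a (dtgt d1) b; rewrite (vdist_sym a (dtgt d1)).
  by move: mab; rewrite /between (vdist_sym a m); lia.
have [q [wq uq sq]] := simple_walk (walk_cat wp2 (walk_cat wrp wrp1)).
have sub p' v w : @walk X v p' w -> m \notin walk_verts p' w ->
    m \notin map (@dsrc X) p'.
  by move=> _; rewrite mem_rcons inE negb_or => /andP[].
have mq : m \notin walk_verts q (dtgt d1).
  apply/negP => /sq; rewrite !walk_verts_cat !mem_cat rp1E (negbTE mp1) orbF.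
  by rewrite (negbTE (sub _ _ _ wp2 mp2)) (negbTE (sub _ _ _ wrp _))// rpE.
apply: treeX; exists m, (d2 :: q ++ [:: dart_rev d1]); split => //=.
- split=> //; apply: walk_cat wq _.
  by rewrite /= dsrc_rev dtgt_rev.
- by rewrite map_cat /= dsrc_rev d2m cats1 -/(walk_verts q (dtgt d1)) mq uq.
rewrite map_cat /= cats1 mem_rcons inE negb_or rcons_uniq.
rewrite (simple_walk_edges wq uq) andbT -andbA; apply/and3P; split.
(* Two darts on one edge would either have the same direction, against [neq], or make the edge a
   loop at [m], while [p1] avoids [m]. *)
- apply/eqP; move: d1m neq d2m (walk_verts_head wp1) mp1.
  case: d1 d2 {wp1 wp2 wrp1 rp1E sub q wq uq sq mq} => e1 b1 [e2 b2] + + + + + /= e12.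
  rewrite -{}e12.
  case: b1; case: b2 => //; rewrite /dsrc /dtgt /= => h1 h2 h3 + h4.
    by rewrite h3 (negbTE h4).
  by rewrite h3 (negbTE h4).
- by apply: contra mq => /(walk_edge_verts wq)[]; rewrite d2m.
- by apply: contra mq => /(walk_edge_verts wq)[]; rewrite d1m.
Qed.

(** Two geodesics joined at [c] form a walk from [a] to [b], which has to pass through the cut point
    [m]. *)
Lemma tree_between_or m a b c :
  between m a b -> between m a c \/ between m c b.
Proof.
move=> mab; have [p wp sp] := vdist_walk a c; have [q wq sq] := vdist_walk c b.
have := tree_between_cut mab (walk_cat wp wq).
rewrite walk_verts_cat mem_cat => /orP[mp|/(geodesic_between wq sq)]; last by right.
by left; apply: (geodesic_between wp sp); rewrite mem_rcons inE mp orbT.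
Qed.

(* The exact median of [x], [y], [a] exists as well, but the last point of a
   geodesic from [x] to [y] which lies between [x] and [a] is good enough. *)
Lemma tree_median x y a : exists m, [/\ between m x y, between m x a
  & (vdist y m + vdist m a <= vdist y a + 2)%N].
Proof.
pose Q n := `[< exists m, [/\ between m x y, between m x a & vdist x m = n] >].
have Q0 : exists n, Q n.
  by exists 0%N; apply/asboolP; exists x; rewrite /between !vdistxx.
have Qle n : Q n -> (n <= vdist x y)%N.
  by move=> /asboolP[m [mxy _ <-]]; rewrite -mxy leq_addr.
case: (ex_maxnP Q0 Qle) => n /asboolP[m [mxy mxa xm]] nmax.
exists m; split => //.
have [->|/eqP my] := eqVneq m y; first by rewrite vdistxx leq_addr.
have [d [p [dm /vdist_le wp sp _]]] := first_step my.
have dd : (vdist m (dtgt d) <= 1)%N by apply: (@vdist_le _ _ _ [:: d]).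
have dxy : between (dtgt d) x y /\ vdist x (dtgt d) = n.+1.
  have := vdist_triangle x m (dtgt d); have := vdist_triangle x (dtgt d) y.
  by move: mxy; rewrite /between; lia.
(* By maximality of [n], the next vertex towards [y] is not between [x] and [a], hence is between
   [a] and [y]. Its distance 1 to [m], counted twice, is the error 2. *)
have [dxa|] := tree_between_or a dxy.1.
  suff : (n.+1 <= n)%N by rewrite ltnn.
  by apply: nmax; apply/asboolP; exists (dtgt d); case: dxy.
rewrite /between (vdist_sym a y) => <-.
have := vdist_triangle m (dtgt d) a; have := vdist_triangle m (dtgt d) y.
by rewrite (vdist_sym y m) (vdist_sym a (dtgt d)); lia.
Qed.

(** As [m] separates [x] from [y], it lies between [b] and one of them. Regrouping the four
    distances to [m] then gives one of the sums on the right, up to the error of the median. *)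
Lemma tree_four_point x y a b : (vdist x y + vdist a b <=
  maxn (vdist x a + vdist y b) (vdist x b + vdist y a) + 2)%N.
Proof.
have [m [mxy mxa mya]] := tree_median x y a.
have := vdist_triangle a m b.
rewrite (vdist_sym a m); move: (mxy) mxa mya; rewrite /between (vdist_sym y m).
case: (tree_between_or b mxy); rewrite /between.
  by lia.
by rewrite (vdist_sym b m) (vdist_sym b y); lia.
Qed.

End Trees.

Definition locally_finite (X : multigraph) : Prop :=
  forall v : vert X, finite_set [set d : dart X | dsrc d = v].

Lemma finite_vdist_ball (X : graph) : locally_finite X ->
  forall (v : vert X) n, finite_set [set w | (vdist v w <= n)%N].
Proof.
move=> lf v n; elim: n v => [|n IH] v.
  apply: (sub_finite_set _ (finite_set1 v)) => w /=.
  by rewrite leqn0 => /eqP/vdist_eq0.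
apply: (@sub_finite_set _ _ ([set v] `|`
    \bigcup_(d in [set d | dsrc d = v]) [set w | (vdist (dtgt d) w <= n)%N])).
  move=> w /= vw; have [p] := vdist_walk v w; case: p => [->|d p]; first by left.
  move=> [dv /vdist_le wp] sp; right; exists d => //=.
  by rewrite -ltnS (leq_trans _ vw)// -sp.
by rewrite finite_setU; split => //; apply: bigcup_finite.
Qed.

(** * Acylindrical actions *)


Section VertexApproximation.
Variables (R : realType) (X : graph).
Implicit Types (x y z w : metric_graph R X).

Lemma mdist_Vertex (v w : vert X) :
  mdist (Vertex v) (Vertex w : metric_graph R X) = (vdist v w)%:R.
Proof.
rewrite /mdist /= /path_dist /dist_via /via /= addr0 add0r.
by rewrite !minxx.
Qed.

Lemma mdist_foot x b : mdist x (Vertex (foot x b)) <= 1.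
Proof.
rewrite (le_trans (path_dist_via x (Vertex (foot x b)) b true))//.
rewrite /via /= vdistxx !addr0; case: x => [v|e [s /= /andP[s0 s1]]] //=.
by case: b; lra.
Qed.

(** Moving each point to a vertex at distance at most 1 changes a distance by at most 2 and a sum of
    two by at most 4. With the error 2 for vertices, this makes 4 + 4 + 2 = 2 * 5. *)
Lemma tree_metric_four_point :
  simplicial_tree X -> four_point (metric_graph R X) 5.
Proof.
move=> treeX x y z w.
pose f x : vert X := foot x true.
have approx a b : (mdist a b <= (vdist (f a) (f b))%:R + 2 /\
    (vdist (f a) (f b))%:R <= mdist a b + 2).
  rewrite -(mdist_Vertex (f a)).
  have := mdist_foot a true; have := mdist_foot b true.
  rewrite -/(f a) -/(f b) => h1 h2.
  have := metric_triangle a (Vertex (f a)) b.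
  have := metric_triangle (Vertex (f a)) (Vertex (f b)) b.
  have := metric_triangle (Vertex (f a)) a (Vertex (f b)).
  have := metric_triangle a b (Vertex (f b)).
  rewrite (metric_sym (Vertex (f a)) a) (metric_sym (Vertex (f b)) b).
  by split; lra.
have := tree_four_point treeX (f x) (f y) (f z) (f w).
rewrite -(ler_nat R) !natrD natr_max !natrD.
have := approx x y; have := approx z w; have := approx x z.
have := approx y w; have := approx x w; have := approx y z.
rewrite /Num.max; do 2 case: ifP => [|/negbT]; rewrite -?leNgt; lra.
Qed.

End VertexApproximation.

Lemma exists_natr_ge (R : realType) (r : R) : exists n : nat, r <= n%:R.
Proof. by exists (Num.truncn r).+1; exact/ltW/truncnS_gt. Qed.

Section Acylindrical.
Variables (R : realType) (X : graph) (G : groupType).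
Variable act : G -> metric_graph R X -> metric_graph R X.
Hypothesis isom : acts_by_graph_isometries act.
Implicit Types (x y : metric_graph R X) (g h : G).

Lemma act1 x : act 1%g x = x. Proof. by case: isom. Qed.

Lemma actM g h x : act (g * h)%g x = act g (act h x).
Proof. by case: isom. Qed.

Lemma act_mdist g x y : mdist (act g x) (act g y) = mdist x y.
Proof. by case: isom => _ _ /(_ g)[]. Qed.

Lemma act_Vertex g v : exists w, act g (Vertex v) = Vertex w.
Proof. by case: isom => _ _ /(_ g)[_ /(_ v)]. Qed.

Lemma actK g x : act g^-1%g (act g x) = x.
Proof. by rewrite -actM mulVg act1. Qed.

Lemma orbit_mdist x g h :
  mdist (act g x) (act h x) = mdist x (act (g^-1 * h)%g x).
Proof. by rewrite actM -(act_mdist g^-1%g) actK. Qed.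

(** The elements sending [x] and [y] to prescribed points are none or a coset of the finite
    stabilizer of the pair, and only finitely many prescriptions occur. *)
Lemma acylindrical_finite_moves : acylindrical act ->
  exists l : R, forall x y (F F' : set (metric_graph R X)),
    l <= mdist x y -> finite_set F -> finite_set F' ->
    finite_set [set g | F (act g x) /\ F' (act g y)].
Proof.
move=> [l _ [N acyl]]; exists l => x y F F' lxy finF finF'.
have fin_stab : finite_set [set g | act g x = x /\ act g y = y].
  exact: card_le_finite (acyl _ _ lxy) (finite_II N).
apply: (@sub_finite_set _ _ (\bigcup_(x' in F) \bigcup_(y' in F')
    [set g | act g x = x' /\ act g y = y'])).
  by move=> g [Fx Fy]; exists (act g x) => //; exists (act g y).
apply: bigcup_finite => // x' _; apply: bigcup_finite => // y' _.
have [[g0 [<- <-]]|no] := pselect (exists g, act g x = x' /\ act g y = y').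
  apply: (sub_finite_set _ (finite_image (fun h => (g0 * h)%g) fin_stab)).
  move=> g /= [gx gy].
  by exists (g0^-1 * g)%g; rewrite ?mulVKg// !actM gx gy !actK.
by apply: (sub_finite_set _ (finite_set0 _)) => g hg; apply: no; exists g.
Qed.

(* A form of Bestvina and Fujiwara's weak proper discontinuity. *)
Definition coarsely_discontinuous : Prop :=
  forall r : R, exists l : R, forall o y o' z : vert X,
    l <= (vdist o y)%:R ->
    finite_set [set g | mdist (act g (Vertex o)) (Vertex o') <= r /\
                        mdist (act g (Vertex y)) (Vertex z) <= r].

Lemma locally_finite_coarsely_discontinuous :
  locally_finite X -> acylindrical act -> coarsely_discontinuous.
Proof.
move=> lf /acylindrical_finite_moves[l moves] r; exists l => o y o' z loy.
have [n rn] := exists_natr_ge r.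
pose B v : set (metric_graph R X) :=
  [set Vertex w | w in [set w | (vdist v w <= n)%N]].
have finB v : finite_set (B v) by exact/finite_image/finite_vdist_ball.
have BP g v w : mdist (act g (Vertex w)) (Vertex v) <= r -> B v (act g (Vertex w)).
  have [w' ->] := act_Vertex g w; rewrite metric_sym mdist_Vertex => vw.
  by exists w' => //=; rewrite -(ler_nat R) (le_trans vw rn).
apply: (sub_finite_set _ (moves (Vertex o) (Vertex y) (B o') (B z) _ _ _)) => //.
  by move=> g /= [h1 h2]; split; apply: BP.
by rewrite mdist_Vertex.
Qed.

Lemma act_between g m a b m' a' b' : act g (Vertex m) = Vertex m' ->
  act g (Vertex a) = Vertex a' -> act g (Vertex b) = Vertex b' ->
  vdist a' b' = vdist a b /\ (between m a b -> between m' a' b').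
Proof.
have vd u v u' v' : act g (Vertex u) = Vertex u' ->
    act g (Vertex v) = Vertex v' -> vdist u' v' = vdist u v.
  move=> hu hv; have := act_mdist g (Vertex u) (Vertex v).
  by rewrite hu hv !mdist_Vertex => /eqP; rewrite eqr_nat => /eqP.
move=> hm ha hb; rewrite (vd _ _ _ _ ha hb); split => //.
by rewrite /between (vd _ _ _ _ ha hb) (vd _ _ _ _ ha hm) (vd _ _ _ _ hm hb).
Qed.

(* If [g] moves [o] and [y] by less than the distances from [m] to [o] and [y],
   then the point [m] of the segment [o, y] is sent to any given walk between
   the targets, as the ends of the translated segment cannot be connected
   otherwise. *)
Lemma tree_coarsely_discontinuous :
  simplicial_tree X -> acylindrical act -> coarsely_discontinuous.
Proof.
move=> treeX /acylindrical_finite_moves[l moves] r.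
have [n rn] := exists_natr_ge r; have [k lk] := exists_natr_ge l.
(* Leaves room for two vertices at distance [n.+1] from the two ends and still at least [k], hence
   [l], apart. *)
exists (2 * n.+1 + k)%:R => o y o' z; rewrite ler_nat => loy.
have [q wq _] := vdist_walk o' z.
have [m1 m1oy om1] := @between_point _ o y n.+1 ltac:(lia).
have [m2 m2oy om2] := @between_point _ o y (vdist o y - n.+1) ltac:(lia).
pose F : set (metric_graph R X) := [set Vertex w | w in [set` walk_verts q z]].
have finF : finite_set F by exact/finite_image/finite_seq.
have FP g m : between m o y -> (n < vdist o m)%N -> (n < vdist m y)%N ->
    mdist (act g (Vertex o)) (Vertex o') <= r ->
    mdist (act g (Vertex y)) (Vertex z) <= r -> F (act g (Vertex m)).
  move=> moy om my.
  have [og ogE] := act_Vertex g o; have [yg ygE] := act_Vertex g y.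
  have [mg mgE] := act_Vertex g m; rewrite ogE ygE mgE !mdist_Vertex => h1 h2.
  have {h1} : (vdist og o' <= n)%N by rewrite -(ler_nat R) (le_trans h1).
  have {h2} : (vdist z yg <= n)%N by rewrite -(ler_nat R) vdist_sym (le_trans h2).
  have [p wp <-] := vdist_walk og o'; have [s ws <-] := vdist_walk z yg => sn pn.
  have [eoy bm] := act_between mgE ogE ygE.
  have [eom _] := act_between ogE ogE mgE; have [emy _] := act_between ogE mgE ygE.
  have := tree_between_cut treeX (bm moy) (walk_cat wp (walk_cat wq ws)).
  have far t u v : @walk X u t v -> mg \in walk_verts t v ->
      (vdist u mg <= size t /\ vdist mg v <= size t)%N.
    move=> wt /(walk_split wt)[t1 [t2 [-> /vdist_le w1 /vdist_le w2]]].
    by rewrite size_cat; lia.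
  (* The first and last pieces have at most [n] darts, and [mg] is farther than [n] from both ends,
     so it is on the middle piece. *)
  rewrite !walk_verts_cat !mem_cat => /or3P[mp|mq|ms].
  - have [] := far _ _ _ wp; last by lia.
    by rewrite mem_rcons inE mp orbT.
  - by exists mg => //=; rewrite mem_rcons inE mq orbT.
  - by have [] := far _ _ _ ws ms; lia.
apply: (sub_finite_set _ (moves (Vertex m1) (Vertex m2) F F _ _ _)) => //.
  move: m1oy m2oy; rewrite /between => b1 b2.
  by move=> g /= [h1 h2]; split; apply: FP => //; rewrite /between; lia.
rewrite mdist_Vertex (le_trans lk)// ler_nat.
by have := vdist_triangle o m1 m2; lia.
Qed.

End Acylindrical.

(** * Axes of loxodromic elements *)


Lemma finite_bound (R : realType) (T : Type) (A : set T) (f : T -> R) :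
  finite_set A -> exists2 M : R, 0 <= M & forall x, A x -> f x <= M.
Proof.
move=> /(finite_image f)/finite_seqP[s sE].
suff [M M0 hM] : exists2 M : R, 0 <= M & forall y, y \in s -> y <= M.
  exists M => // x Ax; apply: hM.
  have : (f @` A) (f x) by exists x.
  by rewrite sE.
elim: s {sE} => [|y s [M M0 hM]]; first by exists 0.
exists (Num.max y M); first by rewrite le_max M0 orbT.
by move=> z; rewrite inE le_max => /orP[/eqP ->|/hM ->]; rewrite ?lexx ?orbT.
Qed.

Lemma int_step_ind (P : int -> Prop) : P 0 ->
  (forall n, P n -> P (n + 1)) -> (forall n, P n -> P (n - 1)) -> forall n, P n.
Proof.
move=> P0 PS PP; elim/int_rect => // n Pn; first by rewrite -addn1 PoszD; apply: PS.
by rewrite -addn1 PoszD opprD; apply: PP.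
Qed.

Section IntegerPowers.
Variable G : groupType.
Implicit Types (g h : G) (n m : int).

Lemma gpow_addn1 g n : gpow g (n + 1) = (gpow g n * g)%g.
Proof.
case: n => [k|[|k]]; first by rewrite -PoszD addn1 /= expgSr.
  by rewrite NegzE addNr /= mulVg.
have -> : Negz k.+1 + 1 = Negz k by rewrite !NegzE; lia.
by rewrite /= (expgS g k.+1) invgM mulgVK.
Qed.

Lemma gpow_subn1 g n : gpow g (n - 1) = (gpow g n * g^-1)%g.
Proof. by rewrite -{2}(subrK 1 n) gpow_addn1 mulgK. Qed.

Lemma gpowD g n m : gpow g (n + m) = (gpow g n * gpow g m)%g.
Proof.
elim/int_step_ind: m => [|m IH|m IH]; first by rewrite addr0 /= mulg1.
  by rewrite addrA !gpow_addn1 IH mulgA.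
by rewrite addrA !gpow_subn1 IH mulgA.
Qed.

Lemma gpowN g n : gpow g (- n) = (gpow g n)^-1%g.
Proof. by apply/esym/mulg1_eq; rewrite -gpowD subrr. Qed.

Lemma gpow_expg g k n : gpow (g ^+ k)%g n = gpow g (k%:Z * n).
Proof.
elim/int_step_ind: n => [|n IH|n IH]; first by rewrite mulr0.
  by rewrite gpow_addn1 IH mulrDr mulr1 gpowD.
by rewrite gpow_subn1 IH mulrBr mulr1 gpowD gpowN.
Qed.

End IntegerPowers.

Section LineIsometries.
Variables (R : realType) (psi : R -> R).
Hypothesis psi_isom : forall s t, `|psi s - psi t| = `|s - t|.

Lemma line_isometry :
  (forall t, psi t = psi 0 + t) \/ (forall t, psi t = psi 0 - t).
Proof.
have [|] := pselect (forall t, psi t = psi 0 + t); first by left.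
move=> /existsNP[s hs]; right => t.
have := psi_isom s 0; have := psi_isom t 0; have := psi_isom s t.
rewrite !subr0 => h1 h2 h3.
have s0 : s != 0 by apply/eqP => s0; apply: hs; rewrite s0 addr0.
have norm_eq (x y : R) : `|x| = `|y| -> x = y \/ x = - y.
  by move/eqP; rewrite eqr_norm2 => /orP[]/eqP; [left|right].
have {h3} es : psi s = psi 0 - s by case: (norm_eq _ _ h3); lra.
(* Reversing [s] but not [t] would make the absolute values of [s + t] and [s - t] equal, so [t]
   must be 0. *)
have [et|] := norm_eq _ _ h2; last lra.
have t0 : t = 0.
  by case: (norm_eq _ _ h1); [|move/eqP: s0 => s0]; lra.
by rewrite t0 subr0.
Qed.

End LineIsometries.

Lemma compact_bounded_dist (R : realType) (T : metricType R) (K : set T) (x : T) :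
  compact K -> exists M : R, forall y, K y -> mdist y x <= M.
Proof.
move=> /compact_near_coveringP/(_ R (pinfty_nbhs R)
  (fun M y => mdist y x <= M) _)[].
  move=> y Ky; exists (ball y 1, [set M | mdist y x + 1 <= M]).
    split; first by apply: nbhsx_ballx.
    by exists (mdist y x + 1); split; [exact: num_real|move=> M /ltW].
  move=> [z M] /= []; rewrite ballEmdist /= => yz hM.
  by apply: le_trans hM; have := metric_triangle z y x; rewrite (metric_sym z y); lra.
by move=> M [_ hM]; exists (M + 1); apply: hM; rewrite ltrDl.
Qed.

Section Axis.
Variables (R : realType) (X : graph) (G : groupType).
Variable act : G -> metric_graph R X -> metric_graph R X.
Hypothesis isom : acts_by_graph_isometries act.
Implicit Types (x y o : metric_graph R X) (g h : G).

Lemma cocompact_axis_orbit h p x : acts_cocompactly_on act h (range p) ->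
  exists M : R, forall t : R, exists c : int,
    mdist (p t) (act (gpow h c) x) <= M.
Proof.
move=> [K [/(compact_bounded_dist x)[M hM] _ cov]]; exists M => t.
have [c _ [y Ky <-]] := cov (p t) (imageT p t).
by exists c; rewrite act_mdist// hM.
Qed.

(** On the axis [h] is a translation or a reflection of a line. A trivial translation or a
    reflection would give [p 0] a bounded orbit, which cannot be coarsely dense in the axis. *)
Lemma axis_translation h p : bi_infinite_geodesic p ->
  act h @` range p = range p -> acts_cocompactly_on act h (range p) ->
  exists2 tau : R, tau != 0 &
    forall (c : int) t, act (gpow h c) (p t) = p (t + tau * c%:~R).
Proof.
move=> geo stab /(@cocompact_axis_orbit h p (p 0))[M hM].
have psiE t : exists s, act h (p t) = p s.
  have : range p (act h (p t)) by rewrite -stab; exists (p t) => //; exists t.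
  by move=> [s _ <-]; exists s.
have {psiE} [psi psiE] := choice psiE.
have psi_isom s t : `|psi s - psi t| = `|s - t|.
  by rewrite -!geo -!psiE act_mdist.
have p_inj s t : p s = p t -> s = t.
  move=> st; apply/eqP; rewrite -subr_eq0 -normr_eq0 -geo st.
  by rewrite mdistxx.
have M0 : 0 <= M by have [c] := hM 0; exact: le_trans (mdist_ge0 _ _).
have [trans|refl] := line_isometry psi_isom.
  have powE (c : int) t : act (gpow h c) (p t) = p (t + psi 0 * c%:~R).
    elim/int_step_ind: c t => [|c IH|c IH] t.
    - by rewrite mulr0 addr0 act1.
    - rewrite gpow_addn1 actM// psiE IH trans; congr p.
      by rewrite rmorphD /=; lra.
    - have -> : p t = act h (p (t - psi 0)).
        by rewrite psiE trans; congr p; lra.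
      rewrite gpow_subn1 actM// actK// IH; congr p.
      by rewrite rmorphB /=; lra.
  exists (psi 0) => //; apply/eqP => psi0.
  have [c] := hM (M + 1); rewrite powE psi0 mul0r addr0 geo subr0.
  by rewrite ger0_norm; lra.
have orb (c : int) : act (gpow h c) (p 0) = p 0 \/ act (gpow h c) (p 0) = p (psi 0).
  have h0 : act h (p (psi 0)) = p 0 by rewrite psiE refl subrr.
  have hV x y : act h x = y -> x = act h^-1%g y by move=> <-; rewrite actK.
  have comm n : (gpow h n * h = h * gpow h n)%g.
    by rewrite -gpow_addn1 addrC gpowD.
  elim/int_step_ind: c => [|c IH|c IH]; first by left; rewrite act1.
    rewrite gpow_addn1 comm actM//; case: IH => ->; first by right; rewrite psiE.
    by left.
  have -> : gpow h (c - 1) = (h^-1 * gpow h c)%g.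
    by rewrite -(mulgK h (gpow h c)) comm gpow_subn1 !mulgA mulVg mul1g.
  rewrite actM//; case: IH => ->; first by right; rewrite -h0 actK.
  by left; rewrite -psiE actK.
have [c] := hM (M + `|psi 0| + 1).
have n1 := ler_norm (psi 0); have n2 := normr_ge0 (psi 0).
by case: (orb c) => ->; rewrite geo ?subr0 ger0_norm; lra.
Qed.

(** Only [g ^+ k] is known to preserve the axis. Division of the exponent by [k] writes a power of
    [g] as a power of [g ^+ k] times one of finitely many remainders, so its orbit point stays near
    the axis. *)
Lemma loxodromic_axis g o : loxodromic act g -> exists (p : R -> metric_graph R X)
    (M c : R), [/\ bi_infinite_geodesic p, 0 < c,
      forall t, exists n : int, mdist (p t) (act (gpow g n) o) <= M,
      forall n : int, exists t, mdist (p t) (act (gpow g n) o) <= M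
    & forall n : int, c * `|n%:~R| - M <= mdist o (act (gpow g n) o)].
Proof.
move=> [k [p [k1 geo stab cocpt]]].
have [M1 hM1] := cocompact_axis_orbit o cocpt.
have [tau tau0 tauE] := axis_translation geo stab cocpt.
have k0 : k%:Z != 0 by case: k k1 {stab cocpt tauE hM1}.
have [M2 M20 hM2] := finite_bound
  (fun i : nat => mdist (p 0) (act (gpow g i) o)) (finite_II k).
have near n : mdist (p (tau * (n %/ k)%Z%:~R)) (act (gpow g n) o) <= M2.
  rewrite [in gpow g n](divz_eq n k) (mulrC _ k%:Z) gpowD -[tau * _]add0r.
  rewrite -tauE gpow_expg actM// act_mdist//.
  have := modz_ge0 n k0; have := ltz_mod n k0.
  by case: (n %% k)%Z => // i ik _; apply: hM2.
have kR : 0 < k%:R :> R by rewrite ltr0n.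
(* The speed is the translation length per power of [g]. In the second bound, [2 * M2] pays for
   moving two orbit points to the axis and the translation length for rounding [n / k]. *)
exists p, (Num.max M1 (2 * M2 + `|tau|)), (`|tau| / k%:R); split => //.
- by rewrite divr_gt0// normr_gt0.
- move=> t; have [n hn] := hM1 t; exists (k%:Z * n).
  by rewrite -gpow_expg le_max hn.
- move=> n; exists (tau * (n %/ k)%Z%:~R); rewrite le_max; apply/orP; right.
  by apply: le_trans (near n) _; have := normr_ge0 tau; lra.
move=> n; apply: (@le_trans _ _ (`|tau| / k%:R * `|n%:~R| - (2 * M2 + `|tau|))).
  by rewrite lerB// le_max lexx orbT.
have := near n; have := near 0; rewrite div0z mulr0 /= act1// => h0 hn.
have := metric_triangle (p 0) o (p (tau * (n %/ k)%Z%:~R)).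
have := metric_triangle o (act (gpow g n) o) (p (tau * (n %/ k)%Z%:~R)).
rewrite (metric_sym (act _ o)) geo sub0r normrN normrM.
suff : `|tau| / k%:R * `|n%:~R| <= `|tau| * `|(n %/ k)%Z%:~R| + `|tau|; first lra.
rewrite -mulrA -{3}(mulr1 `|tau|) -mulrDr ler_wpM2l//.
rewrite mulrC ler_pdivrMr// mulrDl mul1r -{1}[k%:R]gtr0_norm// -normrM.
rewrite {1}(divz_eq n k) rmorphD rmorphM /=.
rewrite (le_trans (ler_normD _ _))// lerD2l ger0_norm ?ler0z ?modz_ge0//.
have := ltz_mod n k0; rewrite -(ltr_int R) /= => /ltW; apply: le_trans.
by [].
Qed.

End Axis.

(** * Paths avoiding the powers of a loxodromic element *)


Section ProductSets.
Variable G : groupType.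
Implicit Types (B : set G) (w : nat -> G).

Fixpoint product_set B n : set G :=
  if n is n'.+1 then [set (x * y)%g | x in product_set B n' & y in B]
  else [set 1%g].

Lemma finite_product_set B n : finite_set B -> finite_set (product_set B n).
Proof.
by move=> finB; elim: n => [|n IH] /=; [exact: finite_set1|exact: finite_image2].
Qed.

Definition steps_in B w n : Prop :=
  forall i, (i < n)%N -> B ((w i)^-1 * w i.+1)%g.

Lemma steps_in_product B w n i m : steps_in B w n -> (i + m <= n)%N ->
  product_set B m ((w i)^-1 * w (i + m)%N)%g.
Proof.
move=> stepw; elim: m => [|m IH] imn; first by rewrite addn0 /= mulVg.
exists ((w i)^-1 * w (i + m)%N)%g; first by apply: IH; lia.
exists ((w (i + m)%N)^-1 * w (i + m).+1)%g; first by apply: stepw; lia.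
by rewrite addnS mulgA mulgK.
Qed.

Lemma steps_in_shift B w n i m : steps_in B w n -> (i + m <= n)%N ->
  steps_in B (fun k => w (i + k)%N) m.
Proof. by move=> stepw imn k km; rewrite addnS; apply: stepw; lia. Qed.

End ProductSets.

Lemma finite_int_ball (N : nat) : finite_set [set c : int | (`|c| <= N)%N].
Proof.
apply: (@sub_finite_set _ _ ((Posz @` `I_N.+1) `|`
    ((fun n : nat => - n%:Z) @` `I_N.+1))).
  by case=> n /= nN; [left; exists n|right; exists n.+1; rewrite ?NegzE].
by rewrite finite_setU; split; apply/finite_image/finite_II.
Qed.

Section PowersNeighborhood.
Variables (R : realType) (G : groupType).
Implicit Types (g : G) (F B : set G).

Definition hits g F (u : G) : Prop :=
  exists (a : int) (f : G), F f /\ u = (gpow g a * f)%g.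

(** All that is retained of the action on [X]: outside a suitable finite neighborhood of the powers
    of [g], paths advance along these powers at an arbitrarily small rate. Here [n] counts the steps
    between points that are not hits. *)
Definition bounded_excursions g (c : R) : Prop :=
  forall B (eps : R), finite_set B -> 0 < eps ->
  exists F (C : R), [/\ finite_set F, F 1%g &
    forall w n a b f f', F f -> F f' -> steps_in B w n.+2 ->
      w 0%N = (gpow g a * f)%g -> w n.+2 = (gpow g b * f')%g ->
      (forall i, (0 < i < n.+2)%N -> ~ hits g F (w i)) ->
      c * `|(b - a)%:~R| <= eps * n%:R + C].

End PowersNeighborhood.

(** * Progress along the axis under a coarsely discontinuous action *)

Section Excursions.
Variables (R : realType) (X : graph) (G : groupType).
Variable act : G -> metric_graph R X -> metric_graph R X.
Hypothesis isom : acts_by_graph_isometries act.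
Hypothesis disc : coarsely_discontinuous act.
Variables (delta : R) (delta0 : 0 <= delta).
Hypothesis hyp : four_point (metric_graph R X) delta.

Variables (v0 : vert X) (g : G) (p : R -> metric_graph R X) (M c : R).
Let o : metric_graph R X := Vertex v0.
Hypotheses (geo : bi_infinite_geodesic p) (c0 : 0 < c).
Hypothesis axis_near :
  forall t, exists n : int, mdist (p t) (act (gpow g n) o) <= M.
Hypothesis orbit_near :
  forall n : int, exists t, mdist (p t) (act (gpow g n) o) <= M.
Hypothesis progress :
  forall n : int, c * `|n%:~R| - M <= mdist o (act (gpow g n) o).

Let coord t0 u : R := axis_coord (p (- t0)) (p t0) (act u o).

Let gap t0 u v : R := `|coord t0 u - coord t0 v|.

Lemma gapxx t0 u : gap t0 u u = 0.
Proof. by rewrite /gap subrr normr0. Qed.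

Lemma gap_sym t0 u v : gap t0 u v = gap t0 v u.
Proof. exact: distrC. Qed.

Lemma gap_triangle t0 v u w : gap t0 u w <= gap t0 u v + gap t0 v w.
Proof. exact: ler_distD. Qed.

Lemma gap_lip t0 u v : gap t0 u v <= mdist (act u o) (act v o).
Proof. exact: axis_coord_lip. Qed.

Let height t0 u : R := axis_height (p (- t0)) (p t0) (act u o).

Lemma low_near_axis t0 u r : 0 <= t0 -> height t0 u < r ->
  exists a : int, mdist (act u o) (act (gpow g a) o) <= r + 2 * delta + M.
Proof.
move=> t00 hu; have := axis_height_dist geo (act u o) t00 hyp.
rewrite -/(height t0 u); set x := p _ => xu.
have [a ha] := axis_near (axis_coord (p (- t0)) (p t0) (act u o)); exists a.
by have := metric_triangle (act u o) x (act (gpow g a) o); rewrite -/x in ha *; lra.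
Qed.

(** For each of the finitely many pairs [u], [m], the element [v] carries two far apart points close
    to given ones. In the application, [v] is a point of a path near the axis, modulo a power of
    [g], and [u] is the increment to a later such point. *)
Lemma finite_translates r l (U : set G) (N : nat) :
  (forall v y o' z : vert X, l <= (vdist v y)%:R ->
    finite_set [set g | mdist (act g (Vertex v)) (Vertex o') <= r /\
                        mdist (act g (Vertex y)) (Vertex z) <= r]) ->
  finite_set U ->
  finite_set [set v | exists u (m : int), [/\ U u, l <= mdist o (act u o),
    (`|m| <= N)%N, mdist (act v o) o <= r &
    mdist (act (v * u)%g o) (act (gpow g m) o) <= r]].
Proof.
move=> disc_l finU.
apply: (@sub_finite_set _ _ (\bigcup_(u in U `&` [set u | l <= mdist o (act u o)])
    \bigcup_(m in [set m : int | (`|m| <= N)%N])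
     [set v | mdist (act v o) o <= r /\
      mdist (act v (act u o)) (act (gpow g m) o) <= r])).
  move=> v [u [m [Uu lu mN h1 h2]]]; exists u => //; exists m => //.
  by rewrite /= -actM.
apply: bigcup_finite => [|u [_ /= lu]]; first exact: finite_setIl.
apply: bigcup_finite => [|m _]; first exact: finite_int_ball.
have [y yE] := act_Vertex isom u v0; have [z zE] := act_Vertex isom (gpow g m) v0.
by move: lu; rewrite /o yE zE mdist_Vertex; exact: disc_l.
Qed.

(* Far from the axis the projection hardly moves, so a path which progresses at
   a definite rate has two points [w i], [w j] near the axis and far apart from
   each other; discontinuity then leaves finitely many choices for [w i] modulo
   the powers of [g]. *)
Lemma fast_path_hits (B : set G) (eps : R) : finite_set B -> 0 < eps ->
  exists (K : nat) (F : set G), [/\ (0 < K)%N, finite_set F &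
    forall (t0 : R) w n, 0 <= t0 -> (n <= K)%N -> steps_in B w n ->
      eps * K%:R < gap t0 (w 0%N) (w n) ->
      exists2 i, (i <= n)%N & hits g F (w i)].
Proof.
move=> finB eps0; have d0 := delta0.
have [lam lam0 hlam] := finite_bound (fun u => mdist o (act u o)) finB.
(* Long blocks make the rate of progress [delta / J%:R] far from the axis at most [eps / 8]. *)
have [J hJ] := exists_natr_ge (8 * delta / eps + 1).
have J1 : 1 <= J%:R :> R.
  by apply: le_trans hJ; rewrite lerDr divr_ge0 ?mulr_ge0// ltW.
have J0 : (0 < J)%N by rewrite -(ltr_nat R); apply: lt_le_trans J1.
have JR : 0 < J%:R :> R by rewrite ltr0n.
have dJ : delta / J%:R <= eps / 8.
  rewrite ler_pdivrMr//.
  have : 8 * delta / eps <= J%:R by lra.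
  by rewrite ler_pdivrMr//; lra.
(* The height above which blocks of [J] steps contract; [r'] then bounds the distance from a lower
   point to the orbit of the powers of [g]. *)
pose r := (J%:R * lam + 2 * delta) / 2 + 1.
pose r' := r + 2 * delta + M.
have [l hl] := disc r'.
have [l' ll' l'0] : exists2 l' : R, l <= l' & 0 <= l'.
  by exists `|l|; rewrite ?ler_norm.
(* So large that the progress [eps * K%:R], less the losses [eps * K%:R / 8 + delta + lam] on the
   two high parts, is still at least [l']. *)
have [K hK] := exists_natr_ge (2 * (l' + 2 * delta + 2 * lam) / eps + 1).
have K1 : 1 <= K%:R :> R.
  apply: le_trans hK; rewrite lerDr divr_ge0 ?mulr_ge0 ?(ltW eps0)//.
  by rewrite !addr_ge0// mulr_ge0.
have {}hK : 2 * (l' + 2 * delta + 2 * lam) <= eps * K%:R.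
  by rewrite (mulrC eps) -ler_pdivrMr//; lra.
(* Bounds the difference of the exponents of two powers of [g] that are within [r'] of two points of
   the path. *)
have [N hN] := exists_natr_ge ((2 * r' + K%:R * lam + M) / c).
pose U := \bigcup_(m in `I_K.+1) product_set B m.
have finU : finite_set U.
  by apply: bigcup_finite => [|m _]; [exact: finite_II|exact: finite_product_set].
exists K; eexists; split; [|exact: (finite_translates N hl finU)|].
  by rewrite -(ltr_nat R); apply: lt_le_trans K1.
move=> t0 w n t00 nK stepw fast.
have KJ : delta * (K%:R / J%:R + 1) <= eps * K%:R / 8 + delta.
  rewrite mulrDr mulr1 lerD2r mulrCA mulrC (le_trans (ler_wpM2r _ dJ))//; lra.
have lamw i : (i < n)%N -> mdist (act (w i) o) (act (w i.+1) o) <= lam.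
  by move=> /stepw; rewrite (orbit_mdist isom); exact: hlam.
have far i m : (i + m <= n)%N ->
    (forall k, (k <= m)%N -> r <= height t0 (w (i + k)%N)) ->
    gap t0 (w i) (w (i + m)%N) <= eps * K%:R / 8 + delta.
  move=> imn high; apply: le_trans KJ.
  apply: (@le_trans _ _ (delta * (m%:R / J%:R + 1))); last first.
    rewrite ler_wpM2l// lerD2r ler_pM2r ?invr_gt0// ler_nat.
    by clear - imn nK; lia.
  have := @axis_coord_far_progress _ _ delta lam r (p (- t0)) (p t0) J
    (fun k => act (w (i + k)%N) o) m delta0 hyp lam0 J0.
  rewrite addn0; apply => //; first by rewrite /r; lra.
  by move=> k km; rewrite addnS; apply: lamw; clear - km imn; lia.
pose low i := (i <= n)%N && (height t0 (w i) < r).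
have nlow i : (i <= n)%N -> ~~ low i -> r <= height t0 (w i).
  by rewrite /low => ->; rewrite -leNgt.
have [lowE|nolow] := pselect (exists i, low i); last first.
  exfalso; have := far 0%N n (leqnn n) _; rewrite add0n.
  have high k : (k <= n)%N -> r <= height t0 (w (0 + k)%N).
    by move=> kn; apply: nlow => //; apply/negP => lowk; apply: nolow; exists k.
  by move=> /(_ high); lra.
have lown i : low i -> (i <= n)%N by case/andP.
(* The path is high before its first low point and after its last one, so these two must be far
   apart. *)
case: (ex_minnP lowE) => i lowi imin; case: (ex_maxnP lowE lown) => j lowj jmax.
have ij : (i <= j)%N := imin _ lowj.
have [ni nj] := (lown _ lowi, lown _ lowj).
have start : gap t0 (w 0%N) (w i) <= eps * K%:R / 8 + delta + lam.
  case: i lowi imin ij ni => [|i] lowi imin ij ni.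
    by rewrite gapxx !addr_ge0// divr_ge0// mulr_ge0// ltW.
  have := far 0%N i (ltnW ni) _; rewrite add0n.
  have high k : (k <= i)%N -> r <= height t0 (w (0 + k)%N).
    move=> ki; apply: nlow; first by clear - ki ni; lia.
    by apply/negP => /imin; rewrite add0n; clear - ki; lia.
  move=> /(_ high) h1; have h2 := le_trans (gap_lip t0 _ _) (lamw _ ni).
  exact: le_trans (gap_triangle t0 (w i) _ _) (lerD h1 h2).
have finish : gap t0 (w j) (w n) <= eps * K%:R / 8 + delta + lam.
  have [->|/eqP jn] := eqVneq j n.
    by rewrite gapxx !addr_ge0// divr_ge0// mulr_ge0// ltW.
  have := far j.+1 (n - j.+1)%N; rewrite subnKC; last by clear - jn nj; lia.
  have high k : (k <= n - j.+1)%N -> r <= height t0 (w (j.+1 + k)%N).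
    move=> ki; apply: nlow; first by clear - ki jn nj; lia.
    by apply/negP => /jmax; clear; lia.
  move=> /(_ (leqnn n) high) h1.
  have h2 : gap t0 (w j) (w j.+1) <= lam.
    by apply: le_trans (gap_lip t0 _ _) (lamw _ _); clear - jn nj; lia.
  by apply: le_trans (gap_triangle t0 (w j.+1) _ _) _; rewrite addrC lerD.
have wij : l <= mdist (act (w i) o) (act (w j) o).
  apply: le_trans ll' (le_trans _ (gap_lip t0 _ _)).
  have := gap_triangle t0 (w i) (w 0%N) (w n).
  have := gap_triangle t0 (w j) (w i) (w n).
  lra.
have [a ha] := low_near_axis t00 (andP lowi).2.
have [b hb] := low_near_axis t00 (andP lowj).2.
(* Translating by the inverse of [gpow g a] brings [w i] close to the identity and [w j] close to
   [gpow g (b - a)], as seen in [X]. *)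
exists i => //; exists a, ((gpow g a)^-1 * w i)%g; split; last by rewrite mulVKg.
exists ((w i)^-1 * w j)%g, (b - a).
rewrite -(orbit_mdist isom) -mulgA mulVKg; split=> //.
- exists (j - i)%N => /=; first by clear - nj nK; lia.
  by have := steps_in_product stepw (i := i) (m := (j - i)%N); rewrite subnKC//; apply.
- have hw m : (i + m <= n)%N -> mdist (act (w i) o) (act (w (i + m)%N) o) <= m%:R * lam.
    elim: m => [|m IH] im; first by rewrite addn0 mdistxx mul0r.
    rewrite addnS (le_trans (metric_triangle _ (act (w (i + m)%N) o) _))//.
    by rewrite -natr1 mulrDl mul1r lerD ?IH ?lamw//; clear - im; lia.
  have := hw (j - i)%N; rewrite subnKC// => /(_ nj).
  have : (j - i)%:R * lam <= K%:R * lam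
    by rewrite ler_wpM2r// ler_nat; clear - nj nK; lia.
  have := progress (b - a); rewrite (addrC b) gpowD gpowN -(orbit_mdist isom).
  have := metric_triangle (act (gpow g a) o) (act (w i) o) (act (gpow g b) o).
  have := metric_triangle (act (w i) o) (act (w j) o) (act (gpow g b) o).
  rewrite (metric_sym (act (gpow g a) o) (act (w i) o)) => h1 h2 h3 h4 h5.
  rewrite -(ler_nat R) (le_trans _ hN)// ler_pdivlMr// mulrC natr_absz.
  by rewrite intr_norm; rewrite -/r' in ha hb; lra.
- by rewrite metric_sym -(orbit_mdist isom) metric_sym.
rewrite (orbit_mdist isom) (addrC b) gpowD gpowN invgM invgK mulgA mulgK.
by rewrite -(orbit_mdist isom).
Qed.

(** Each block of at most [K] steps progresses by at most [eps * K%:R], and there are at most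
    [n / K + 1] blocks. The identity is put into [F] so that the powers of [g] themselves are
    hits. *)
Lemma avoiding_path_progress (B : set G) (eps : R) : finite_set B -> 0 < eps ->
  exists (K : nat) (F : set G), [/\ finite_set F, F 1%g &
    forall (t0 : R) w n, 0 <= t0 -> steps_in B w n ->
      (forall i, (i <= n)%N -> ~ hits g F (w i)) ->
      gap t0 (w 0%N) (w n) <= eps * (n%:R + K%:R)].
Proof.
move=> finB eps0; have [K [F [K0 finF fast]]] := fast_path_hits finB eps0.
exists K, (F `|` [set 1%g]); split; [|by right|].
  by rewrite finite_setU; split => //; exact: finite_set1.
move=> t0 w n t00 stepw avoid.
have {fast} slow v m : (m <= K)%N -> steps_in B v m ->
    (forall i, (i <= m)%N -> ~ hits g (F `|` [set 1%g]) (v i)) ->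
    gap t0 (v 0%N) (v m) <= eps * K%:R.
  move=> mK stepv avoidv; rewrite leNgt; apply/negP => /(fast _ _ _ t00 mK stepv).
  move=> [i im [a [f [Ff vE]]]]; apply: (avoidv i im).
    by exists a, f; split => //; left.
elim/ltn_ind: n w stepw avoid => n IH w stepw avoid.
have [nK|Kn] := leqP n K.
  apply: le_trans (slow w n nK stepw avoid) _.
  by rewrite ler_wpM2l ?(ltW eps0)// lerDr.
have KnE : (K + (n - K))%N = n by rewrite subnKC// ltnW.
apply: le_trans (gap_triangle t0 (w K) _ _) _.
have -> : n%:R + K%:R = K%:R + ((n - K)%:R + K%:R) :> R.
  by rewrite -{1}KnE natrD addrA.
rewrite mulrDr; apply: lerD.
  apply: slow => //.
    exact: (steps_in_shift (i := 0) stepw (ltnW Kn)).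
  by move=> i iK; apply: avoid; clear - iK Kn; lia.
have := IH (n - K)%N _ (fun k => w (K + k)%N); rewrite addn0 KnE; apply.
- by clear - K0 Kn; lia.
- by apply: (steps_in_shift stepw); rewrite KnE.
- by move=> i iK; apply: avoid; clear - iK Kn; lia.
Qed.

(** With [t0] beyond both nearby points of the axis, their coordinates are exact. Each orbit point
    costs [M] for its distance and [M] for its coordinate. *)
Lemma orbit_gap (a b : int) : exists2 t0 : R, 0 <= t0 &
  mdist (act (gpow g a) o) (act (gpow g b) o)
    <= gap t0 (gpow g a) (gpow g b) + 4 * M.
Proof.
have [ta ha] := orbit_near a; have [tb hb] := orbit_near b.
exists (Num.max `|ta| `|tb|); first by rewrite le_max normr_ge0.
set t0 := Num.max _ _.
have ca := axis_coord_lip (p (- t0)) (p t0) (p ta) (act (gpow g a) o).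
have cb := axis_coord_lip (p (- t0)) (p t0) (p tb) (act (gpow g b) o).
rewrite (axis_coord_geodesic geo) in ca; last by rewrite le_max lexx.
rewrite (axis_coord_geodesic geo) in cb; last by rewrite le_max lexx orbT.
rewrite -/(coord t0 _) in ca; rewrite -/(coord t0 _) in cb.
have := metric_triangle (act (gpow g a) o) (p ta) (act (gpow g b) o).
have := metric_triangle (p ta) (p tb) (act (gpow g b) o).
have := ler_distD (coord t0 (gpow g a)) ta tb.
have := ler_distD (coord t0 (gpow g b)) (coord t0 (gpow g a)) tb.
rewrite (distrC (coord t0 (gpow g b)) tb) (metric_sym _ (p ta)) geo /gap.
lra.
Qed.

Lemma bounded_excursions_axis : bounded_excursions g c.
Proof.
move=> B eps finB eps0; have [K [F [finF F1 slow]]] := avoiding_path_progress finB eps0.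
have [lam lam0 hlam] := finite_bound (fun u => mdist o (act u o)) finB.
have [D D0 hD] := finite_bound (fun u => mdist o (act u o)) finF.
(* Only the inner points avoid [F]: [2 * lam] pays for the first and last steps, [2 * D] for [f] and
   [f'], and [5 * M] for [orbit_gap] and [progress]. *)
exists F, (eps * K%:R + 2 * lam + 2 * D + 5 * M); split => //.
move=> w n a b f f' Ff Ff' stepw w0 wn avoid.
have [t0 t00 gapab] := orbit_gap a b.
have mid : gap t0 (w 1%N) (w n.+1) <= eps * (n%:R + K%:R).
  apply: (slow t0 (fun k => w k.+1)) => //.
    by move=> k kn; apply: stepw; exact: leqW.
  by move=> k kn; apply: avoid.
rewrite mulrDr in mid.
have lamw i : (i < n.+2)%N -> gap t0 (w i) (w i.+1) <= lam.
  move=> /stepw/hlam; rewrite -(orbit_mdist isom); apply: le_trans.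
  exact: gap_lip.
have Dhit m h : F h -> gap t0 (gpow g m) (gpow g m * h)%g <= D.
  move=> /hD; apply: le_trans; rewrite -[h in leRHS](mulKg (gpow g m)).
  by rewrite -(orbit_mdist isom); exact: gap_lip.
have := lamw 0%N isT; have := lamw n.+1 (ltnSn _).
have := Dhit a f Ff; have := Dhit b f' Ff'; rewrite -w0 -wn (gap_sym _ _ (w n.+2)).
have := gap_triangle t0 (w 0%N) (gpow g a) (gpow g b).
have := gap_triangle t0 (w 1%N) (w 0%N) (gpow g b).
have := gap_triangle t0 (w n.+1) (w 1%N) (gpow g b).
have := gap_triangle t0 (w n.+2) (w n.+1) (gpow g b).
have := progress (b - a).
rewrite (addrC b) gpowD gpowN -(orbit_mdist isom).
lra.
Qed.

End Excursions.

(** * Quasi-geodesics in Cayley graphs *)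


Section CayleyGraph.
Variables (G : groupType) (S : seq G).
Hypothesis genS : generates S.
Local Notation Gamma := (cayley_graph genS).

Definition word_dist (u v : G) : nat := @vdist Gamma u v.

Implicit Types (u v h g : G).

Lemma cayley_walk_translate h u v p : @walk Gamma u p v ->
  exists2 q, @walk Gamma (h * u)%g q (h * v)%g & size q = size p.
Proof.
elim: p u => [u ->|[[e s] b] p IH u /= [<- /IH[q wq sq]]]; first by exists [::].
exists (((h * e)%g, s, b) :: q); last by rewrite /= sq.
move: wq; rewrite /dsrc /dtgt /=; case: b {IH} => /=; rewrite ?mulgA => wq;
  by split.
Qed.

Lemma word_dist_translate h u v : word_dist (h * u)%g (h * v)%g = word_dist u v.
Proof.
suff le k u' v' : (word_dist (k * u')%g (k * v')%g <= word_dist u' v')%N.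
  by apply/eqP; rewrite eqn_leq le -{1}(mulKg h u) -{1}(mulKg h v) le.
rewrite /word_dist; have [p wp <-] := @vdist_walk Gamma u' v'.
by have [q wq <-] := cayley_walk_translate k wp; exact: vdist_le.
Qed.

Lemma cayley_locally_finite : locally_finite Gamma.
Proof.
move=> v.
have finS : finite_set [set: {s : G | s \in S}].
  apply: (@sub_finite_set _ _ [set` pmap insub S]) => [s _|]; last exact: finite_seq.
  by rewrite /= mem_pmap_sub; exact: valP.
apply: (@sub_finite_set _ _
  ((fun s => ((v, s), false)) @` [set: {s : G | s \in S}] `|`
   (fun s => (((v * (val s)^-1)%g, s), true)) @` [set: {s : G | s \in S}])).
  move=> [[u s] []] /= <-; last by left; exists s.
  by right; exists s => //; rewrite /dsrc /= mulgK.
by rewrite finite_setU; split; exact: finite_image.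
Qed.

Lemma finite_word_ball n : finite_set [set u | (word_dist 1%g u <= n)%N].
Proof. exact: (finite_vdist_ball cayley_locally_finite). Qed.

Lemma word_dist_gpow_le g (a b : int) :
  (word_dist (gpow g a) (gpow g b) <= word_dist 1%g g * absz (b - a)%R)%N.
Proof.
have nat_case k : (word_dist 1%g (g ^+ k)%g <= word_dist 1%g g * k)%N.
  elim: k => [|k IH]; first by rewrite muln0 /word_dist vdistxx.
  rewrite expgSr mulnS addnC (leq_trans (vdist_triangle _ (g ^+ k : vert Gamma)%g _))//.
  rewrite leq_add// -/(word_dist (g ^+ k)%g (g ^+ k * g)%g).
  by rewrite -{1}(mulg1 (g ^+ k)%g) word_dist_translate.
have -> : gpow g b = (gpow g a * gpow g (b - a))%g.
  by rewrite -gpowD addrC subrK.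
rewrite -{1}(mulg1 (gpow g a)) word_dist_translate.
case: (b - a) => k /=; first exact: nat_case.
rewrite -(word_dist_translate (g ^+ k.+1)%g) mulg1 mulgV /word_dist vdist_sym.
exact: nat_case.
Qed.

Section OrbitMap.
Variables (R : realType) (X : graph).
Variable act : G -> metric_graph R X -> metric_graph R X.
Hypothesis isom : acts_by_graph_isometries act.

Lemma orbit_map_lipschitz o : exists2 lam : R, 0 < lam &
  forall u v, mdist (act u o) (act v o) <= lam * (word_dist u v)%:R.
Proof.
have [lam lam0 hlam] := finite_bound (fun u => mdist o (act u o)) (finite_word_ball 1).
exists (lam + 1) => [|u v]; first by rewrite ltr_wpDl.
rewrite /word_dist; have [p wp <-] := @vdist_walk Gamma u v.
elim: p u wp => [u <-|d p IH u [du /IH{}IH]]; first by rewrite mdistxx mulr0.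
rewrite (le_trans (metric_triangle _ (act (dtgt d) o) _))// [size _]/= -natr1.
rewrite mulrDr mulr1 addrC lerD// orbit_mdist// (@le_trans _ _ lam)// ?lerDl//.
apply: hlam; rewrite /= -(word_dist_translate u) mulg1 mulVKg.
by apply: (@vdist_le _ _ _ [:: d]).
Qed.

End OrbitMap.

End CayleyGraph.

Lemma last_hit_first_hit (P : nat -> Prop) n : P 0%N -> ~ P n ->
  (exists2 m, (n <= m)%N & P m) ->
  exists i j, [/\ (i < n < j)%N, P i, P j & forall k, (i < k < j)%N -> ~ P k].
Proof.
move=> P0 Pn [m nm Pm].
pose Q k := `[< P k >]; have QP k : Q k <-> P k by split => /asboolP.
have exi : exists k, Q k && (k <= n)%N by exists 0%N; rewrite andbT; apply/QP.
have exj : exists k, Q k && (n <= k)%N by exists m; rewrite nm andbT; apply/QP.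
have lei k : Q k && (k <= n)%N -> (k <= n)%N by case/andP.
case: (ex_maxnP exi lei) => i /andP[/QP Pi ni] imax.
case: (ex_minnP exj) => j /andP[/QP Pj nj] jmin.
exists i, j; split => //.
  rewrite !ltn_neqAle ni nj !andbT; apply/andP; split; apply/eqP => e.
    by move: Pi; rewrite e.
  by move: Pj; rewrite -e.
move=> k /andP[ik kj] Pk; have [kn|nk] := leqP k n.
  by have := imax k; rewrite kn andbT leqNgt ik => /(_ (proj2 (QP k) Pk)).
by have := jmin k; rewrite (ltnW nk) andbT leqNgt kj => /(_ (proj2 (QP k) Pk)).
Qed.

(** * Quasi-geodesics with ends on the powers of an element *)

Section MorsePowers.
Variables (R : realType) (G : groupType) (S : seq G).
Hypothesis genS : generates S.
Variable g : G.
Local Notation wd := (word_dist genS).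
Local Notation Cay := (metric_graph R (cayley_graph genS)).
Local Notation q := (power_path genS g : R -> Cay).

Local Notation vtx u := (Vertex (u : vert (cayley_graph genS)) : Cay).

Lemma mdist_word (u v : G) : mdist (vtx u) (vtx v) = (wd u v)%:R.
Proof. exact: mdist_Vertex. Qed.

Lemma power_path_int (n : int) : q n%:~R = vtx (gpow g n).
Proof. by rewrite /power_path intrKfloor. Qed.

Lemma word_dist_gpow_ler (a b : int) :
  (wd (gpow g a) (gpow g b))%:R <= (wd 1%g g)%:R * `|(b - a)%:~R| :> R.
Proof.
by rewrite -intr_norm -natr_absz -natrM ler_nat word_dist_gpow_le.
Qed.

Lemma power_path_quasi_geodesic (c M : R) : 0 < c ->
  (forall a b : int,
    c * `|(b - a)%:~R| - M <= (wd (gpow g a) (gpow g b))%:R) ->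
  bi_infinite_quasi_geodesic q.
Proof.
move=> c0 low; pose lg : R := (wd 1%g g)%:R.
have lg0 : 0 <= lg by exact: ler0n.
have cV : 0 < c^-1 by rewrite invr_gt0.
(* The multiplicative constant serves the upper bound through [lg] and the lower one through [c^-1];
   the additive one absorbs the error made by [Num.floor], at most 1 on the distance of the
   parameters. *)
exists (lg + 1 + c^-1), (lg + c + `|M|); split; first by lra.
  by rewrite !addr_ge0// ltW.
move=> s t _ _; rewrite mdist_word.
set i := Num.floor s; set j := Num.floor t.
have [i1 i2] : i%:~R <= s /\ s < i%:~R + 1.
  by rewrite -[X in _ + X]/(1%:~R) -intrD; split; [exact: floor_le|exact: floorD1_gt].
have [j1 j2] : j%:~R <= t /\ t < j%:~R + 1.
  by rewrite -[X in _ + X]/(1%:~R) -intrD; split; [exact: floor_le|exact: floorD1_gt].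
have := low i j; have := word_dist_gpow_ler i j; rewrite -/lg.
set d : R := (wd _ _)%:R; set m : R := `|_| => up lo.
have st0 := normr_ge0 (s - t).
have [m1 m2] : m <= `|s - t| + 1 /\ `|s - t| <= m + 1.
  have := ler_norm (s - t); have := ler_norm (- (s - t)); rewrite normrN.
  have := ler_norm ((j - i)%:~R : R); have := ler_norm (- (j - i)%:~R : R).
  rewrite normrN -/m rmorphB /= => *.
  by split; [rewrite /m ler_norml rmorphB /=|rewrite ler_norml]; lra.
have Lc : (lg + 1 + c^-1)^-1 <= c.
  by rewrite -[leRHS]invrK lef_pV2 ?posrE//; lra.
apply/andP; split.
  apply: (@le_trans _ _ (c * (m + 1) - (lg + c + `|M|))).
    by rewrite lerB// ler_pM ?invr_ge0//; lra.
  by have := ler_norm M; lra.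
apply: le_trans up _; apply: (@le_trans _ _ (lg * (`|s - t| + 1))).
  by rewrite ler_wpM2l.
rewrite mulrDr mulr1.
have : lg * `|s - t| <= (lg + 1 + c^-1) * `|s - t| by rewrite ler_wpM2r//; lra.
by have := normr_ge0 M; lra.
Qed.

(* [r] is sampled at unit steps. A maximal run of samples avoiding the
   neighborhood [<g> F] of the powers of [g] is short: its ends are close to
   two powers of [g] whose distance grows linearly with the length of the run,
   as [r] is a quasi-geodesic, but also slower than that by the choice of [F]. *)
Lemma bounded_excursions_morse (c L C : R) : 0 < c -> bounded_excursions g c ->
  1 <= L -> 0 <= C -> exists M : R,
    forall (a b : R) (r : R -> Cay), a <= b ->
      quasi_geodesic L C `[a, b] r -> range q (r a) -> range q (r b) ->
      forall t, t \in `[a, b] -> exists s, mdist (r t) (q s) <= M.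
Proof.
move=> c0 exc L1 C0.
pose lg : R := (wd 1%g g)%:R + 1.
have lg0 : 0 < lg by rewrite ltr_wpDl.
have L0 : 0 < L by lra.
(* Bounds the increments of the samples: [L + C] for a unit of time and 2 for rounding both ends to
   vertices. *)
have [s hs] := exists_natr_ge (L + C + 2).
(* At this rate, [k] steps separate the powers by at most [k / (2 * L)] in word length, up to a
   constant: half of the least speed of [r]. *)
have eps0 : 0 < c / (2 * L * lg) by rewrite divr_gt0 ?mulr_gt0.
have [F [C1 [finF F1 hF]]] := exc _ _ (finite_word_ball genS s) eps0.
have [D D0 hD] := finite_bound (fun f => (wd 1%g f)%:R : R) finF.
pose C2 := `|C1| / c * lg.
have C20 : 0 <= C2 by rewrite mulr_ge0 ?divr_ge0// ltW.
pose N := 2 * L * (2 * D + C + 2 + C2).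
(* The part [L + C + 1] leads from [r t] to a sample; the rest leads along the run back to its
   initial hit and from there to a power of [g]. *)
exists (L + C + 1 + (D + 2 + L * (N + 2) + C)).
move=> a b r ab qg [sa _ ra] [sb _ rb] t; rewrite in_itv /= => /andP[at_ tb].
(* Cut off at [b], so that every index gives a sample and all late ones are the end of [r], a
   hit. *)
pose tau n : R := Num.min (a + n%:R) b.
have tau_in n : tau n \in `[a, b].
  by rewrite in_itv /= /tau le_min ab lerDl ler0n ge_min lexx orbT.
have tau_step m n : (m <= n)%N -> 0 <= tau n - tau m <= (n - m)%:R.
  move=> mn; have : (m%:R : R) <= n%:R by rewrite ler_nat.
  by rewrite natrB// /tau /Num.min; case: ifP; case: ifP; lra.
pose x n : G := foot (r (tau n)) true.
have rx n : mdist (r (tau n)) (vtx (x n)) <= 1.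
  exact: mdist_foot.
have qg_tau m n : (m <= n)%N -> L^-1 * (tau n - tau m) - C <=
    mdist (r (tau m)) (r (tau n)) <= L * (tau n - tau m) + C.
  move=> mn; have := qg _ _ (tau_in m) (tau_in n).
  by rewrite distrC ger0_norm//; have /andP[] := tau_step _ _ mn.
have wdx m n : (m <= n)%N -> L^-1 * (tau n - tau m) - C - 2 <= (wd (x m) (x n))%:R
    <= L * (tau n - tau m) + C + 2.
  move=> mn; rewrite -mdist_word; have /andP[h1 h2] := qg_tau m n mn.
  have := rx m; have := rx n.
  have := metric_triangle (r (tau m)) (vtx (x m)) (r (tau n)).
  have := metric_triangle (vtx (x m)) (vtx (x n)) (r (tau n)).
  have := metric_triangle (vtx (x m)) (r (tau m)) (vtx (x n)).
  have := metric_triangle (r (tau m)) (r (tau n)) (vtx (x n)).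
  rewrite (metric_sym (vtx (x m)) (r _)).
  rewrite (metric_sym (vtx (x n)) (r _)).
  by move=> *; apply/andP; split; lra.
have steps : forall i, (wd 1%g ((x i)^-1 * x i.+1)%g <= s)%N.
  move=> i; rewrite -(word_dist_translate genS (x i)) mulg1 mulVKg -(ler_nat R).
  have /andP[_ h] := wdx i i.+1 (leqnSn i).
  have /andP[_ h'] := tau_step i i.+1 (leqnSn i).
  rewrite subSnn in h'; apply: le_trans h (le_trans _ hs).
  have : L * (tau i.+1 - tau i) <= L * 1 by rewrite ler_wpM2l// ltW.
  by lra.
have Dg m f : F f -> mdist (vtx (gpow g m)) (vtx (gpow g m * f)%g) <= D.
  move=> /hD; rewrite mdist_word -{1}(mulg1 (gpow g m)) word_dist_translate.
  exact.
pose P n := hits g F (x n).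
have hit_q n : P n -> exists s, mdist (vtx (x n)) (q s) <= D.
  move=> [m [f [Ff xE]]]; exists m%:~R.
  by rewrite power_path_int metric_sym xE; exact: Dg.
have P_end n u : r (tau n) = q u -> P n.
  by move=> rE; exists (Num.floor u), 1%g; rewrite mulg1 /x rE.
have Pa : P 0%N.
  by apply: (P_end _ sa); rewrite ra /tau addr0; congr r; rewrite min_l.
have Pb n : b <= a + n%:R -> P n.
  by move=> bn; apply: (P_end _ sb); rewrite rb /tau; congr r; rewrite min_r.
have near n : exists s, mdist (vtx (x n)) (q s)
    <= D + 2 + L * (N + 2) + C.
  have N0 : 0 <= N by rewrite !mulr_ge0 ?(ltW L0)// !addr_ge0// mulr_ge0.
  have LN0 : 0 <= L * (N + 2) by rewrite mulr_ge0 ?(ltW L0)//; lra.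
  have [/hit_q[u hu]|Pn] := pselect (P n); first by exists u; lra.
  have [|i [j [/andP[i_n nj] Pi Pj nP]]] := last_hit_first_hit Pa Pn.
    have [m hm] := exists_natr_ge (b - a); exists (n + m)%N; first exact: leq_addr.
    by apply: Pb; rewrite natrD; have : 0 <= n%:R :> R by []; lra.
  have [u hu] := hit_q i Pi; exists u.
  have ij : (i <= j)%N by clear - i_n nj; lia.
  have [k jE] : exists k, j = (i + k.+2)%N.
    by exists (j - i).-2; clear - i_n nj; lia.
  case: Pi Pj => [m [f [Ff xi]]] [m' [f' [Ff' xj]]].
  have kN : k%:R <= N.
    have := hF (fun l => x (i + l)%N) k m m' f f' Ff Ff' _ _ _ _.
    rewrite addn0 -jE => /(_ _ xi xj _)exc_mm.
    have {exc_mm} : c * `|(m' - m)%:~R| <= c / (2 * L * lg) * k%:R + C1.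
      apply: exc_mm => [l _|l /andP[l0 lk]]; first by rewrite addnS; apply: steps.
      by apply: nP; rewrite jE; clear - l0 lk; lia.
    set e : R := `|_| => h.
    have {h} eb : lg * e <= L^-1 * k%:R / 2 + C2.
      have -> : L^-1 * k%:R / 2 + C2 =
          lg * (c^-1 * (c / (2 * L * lg) * k%:R + `|C1|)).
        by rewrite /C2; field; rewrite !gt_eqF.
      rewrite ler_wpM2l ?(ltW lg0)// ler_pdivlMl// (le_trans h)// lerD2l.
      exact: ler_norm.
    have ne : (wd 1%g g)%:R * e <= lg * e by rewrite ler_wpM2r ?normr_ge0// /lg lerDl.
    have := word_dist_gpow_ler m m'; rewrite -/e.
    have /andP[+ _] := wdx i j ij.
    have := Dg m f Ff; have := Dg m' f' Ff'; rewrite -xi -xj -!mdist_word.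
    have := metric_triangle (vtx (x i)) (vtx (gpow g m)) (vtx (x j)).
    have := metric_triangle (vtx (gpow g m)) (vtx (gpow g m')) (vtx (x j)).
    rewrite (metric_sym (vtx (x i)) (vtx (gpow g m))) => h1 h2 h3 h4 h5.
    rewrite (mdist_word 1%g g) => h6.
    (* The sample just before [j] is not a hit, so it comes before time [b]: the first [k.+1] steps
       of the run last a full unit each. *)
    have : L^-1 * (k%:R + 1) <= L^-1 * (tau j - tau i).
      rewrite ler_wpM2l ?invr_ge0 ?(ltW L0)//.
      have : a + (i + k.+1)%:R < b.
        rewrite ltNge; apply/negP => /Pb; apply: nP; rewrite jE.
        by clear; lia.
      rewrite /tau jE !natrD -!natr1 /Num.min.
      by case: ifP; case: ifP; lra.
    rewrite mulrDr mulr1 => h7.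
    have Li : 0 <= L^-1 by rewrite invr_ge0 ltW.
    have : L^-1 * k%:R <= 2 * (2 * D + C + 2 + C2) by lra.
    by rewrite ler_pdivrMl// /N mulrCA mulrA.
  have /andP[_ h] := wdx i n (ltnW i_n); have /andP[_ h'] := tau_step i n (ltnW i_n).
  have : L * (tau n - tau i) <= L * (N + 2).
    rewrite ler_wpM2l ?(ltW L0)// (le_trans h')//.
    apply: (@le_trans _ _ (k + 2)%:R); last by rewrite natrD lerD2r.
    by rewrite ler_nat; clear - jE nj i_n; lia.
  have := metric_triangle (vtx (x n)) (vtx (x i)) (q u).
  by rewrite (metric_sym (vtx (x n)) (vtx (x i))) (mdist_word (x i)); lra.
have ta : 0 <= t - a by rewrite subr_ge0.
have /andP[n1 n2] := truncn_itv ta; set n := Num.truncn _ in n1 n2.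
have [u hu] := near n; exists u.
have tauE : tau n = a + n%:R by rewrite /tau min_l//; lra.
have t_in : t \in `[a, b] by rewrite in_itv /= at_ tb.
have /andP[_ h] := qg _ _ t_in (tau_in n).
have : L * `|t - tau n| <= L * 1.
  rewrite ler_wpM2l ?(ltW L0)// tauE ger0_norm; first by rewrite -natr1 in n2; lra.
  by lra.
have := metric_triangle (r t) (r (tau n)) (q u).
have := metric_triangle (r (tau n)) (vtx (x n)) (q u).
by have := rx n; lra.
Qed.

End MorsePowers.

Theorem theorem1p3 (R : realType) (X : graph) (G : groupType)
    (act : G -> metric_graph R X -> metric_graph R X) :
  simplicial_tree X \/
    (uniformly_locally_finite X /\ gromov_hyperbolic (metric_graph R X)) ->
  finitely_generated G ->
  acts_by_graph_isometries act ->
  acylindrical act ->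
  forall g : G, loxodromic act g -> morse_element R g.
Proof.
move=> geomX fgG isom acyl g lox; split=> // S genS.
have [delta [delta0 hyp disc]] : exists delta : R, [/\ 0 <= delta,
    four_point (metric_graph R X) delta & coarsely_discontinuous act].
  case: geomX => [treeX|[[N deg] /gromov_hyperbolic_four_point[delta delta0 hyp]]].
    exists 5; split; [by []|exact: tree_metric_four_point|].
    exact: tree_coarsely_discontinuous.
  exists delta; split => //; apply: locally_finite_coarsely_discontinuous => // v.
  exact: card_le_finite (deg v) (finite_II N).
(* The axis provides a base vertex. *)
have [_ [p0 _]] := lox; pose v0 := foot (p0 0) true.
have [p [M [c [geo c0 axis_near orbit_near progress]]]] :=
  loxodromic_axis isom (Vertex v0) lox.
have exc := bounded_excursions_axis isom disc delta0 hyp geo c0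
  axis_near orbit_near progress.
have [lam lam0 lip] := orbit_map_lipschitz genS isom (Vertex v0).
split; last by move=> L C; exact: bounded_excursions_morse c0 exc.
(* The orbit map is [lam]-Lipschitz, so linear growth in [X] gives linear growth of the word
   length. *)
apply: (@power_path_quasi_geodesic R G S genS g (c / lam) (M / lam)).
  by rewrite divr_gt0.
move=> a b; rewrite mulrAC -mulrBl ler_pdivrMr// [leRHS]mulrC.
apply: le_trans (lip _ _); rewrite (orbit_mdist isom) -gpowN -gpowD (addrC (- a)).
exact: progress.
Qed.
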